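(* Let $q\ge5$ be an integer. The following hold, where $k,l\in S$ always means $k\ne l$. (1) $\beta_3<q$. (2) For $\beta\in(\beta_1,\beta_3)$, the sets $\mathcal W_k$, $k\in\widehat S$, are nonempty and (pairwise) disjoint. For $k,l\in S$, $\Sigma_{k,l}=\emptyset$, and for $k\in S$, $\Sigma_{\mathfrak o,k}=\{\mathbf v_1^k\}$. (3) For $\beta=\beta_3$, the sets $\mathcal W_k$, $k\in\widehat S$, are nonempty and disjoint. For $k,l\in S$, $\Sigma_{k,l}=\{\mathbf u_2^{k,l}\}$, and for $k\in S$, $\Sigma_{\mathfrak o,k}=\{\mathbf v_1^k\}$. (4) For $\beta\in(\beta_3,\infty)$, the sets $\mathcal W_k$, $k\in S$, are nonempty and disjoint. For $k,l\in S$, $\Sigma_{k,l}=\{\mathbf u_2^{k,l}\}$, and for $k\in S$, $\Sigma_{\mathfrak o,k}=\emptyset$. (5) For $\beta\in(\beta_3,q)$, we have $F_\beta(\mathbf v_1)>H_\beta$. Furthermore, the set $\{F_\beta<F_\beta(\mathbf v_1)\}$ has exactly two connected components: the well $\mathcal W_{\mathfrak o}$ and another one containing $\mathcal U_1$. The saddle points between them (i.e. the points in the intersection of their closures) are the elements of $\mathcal V_1$.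
   Context: Let $q\ge5$, $S=\{1,\dots,q\}$, $\Xi=\{(x_1,\dots,x_{q-1})\in(\mathbb R_{\ge0})^{q-1}: x_1+\cdots+x_{q-1}\le1\}$; a point of $\Xi$ is also written $(x_1,\dots,x_q)$ with $x_q=1-x_1-\cdots-x_{q-1}$. For $\beta>0$ define on $\Xi$ $$F_\beta(x)=-\frac12\sum_{k=1}^q x_k^2+\frac1\beta\sum_{k=1}^q x_k\log x_k\qquad(0\log0=0).$$ Let $\mathbf p=(1/q,\dots,1/q)$. For an integer $1\le i\le q/2$ and $j=q-i$ let $g_i:(0,1/j)\to\mathbb R$, $g_i(t)=\frac{i}{1-qt}\log\frac{1-jt}{it}$ with $g_i(1/q)=q$. It has a unique minimum point; put $\beta_{s,i}=\min g_i$. For $\beta\ge\beta_{s,i}$ the equation $g_i(t)=\beta$ has one or two solutions, denoted $u_i(\beta)\le v_i(\beta)$ (equal if only one). For $k\in S$, $\mathbf u_1^k$ (resp. $\mathbf v_1^k$) is the point with $k$-th coordinate $1-(q-1)u_1(\beta)$ (resp. $1-(q-1)v_1(\beta)$) and all other coordinates $u_1(\beta)$ (resp. $v_1(\beta)$). For $k\ne l$ in $S$, $\mathbf u_2^{k,l}$ is the point with $k$-th and $l$-th coordinates $\frac{1-(q-2)u_2(\beta)}2$ and all other coordinates $u_2(\beta)$. Put $\mathcal U_1=\{\mathbf u_1^k\}_{k\in S}$, $\mathcal V_1=\{\mathbf v_1^k\}_{k\in S}$, $\mathbf u_1=\mathbf u_1^q$, $\mathbf v_1=\mathbf v_1^q$,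 $\mathbf u_2=\mathbf u_2^{q-1,q}$. Critical temperatures: $\beta_1=\beta_{s,1}$; for $q\ge5$, $\beta_3$ is the unique $\beta\in(\beta_{s,2},q)$ with $F_\beta(\mathbf v_1)=F_\beta(\mathbf u_2)$ (it satisfies $F_\beta(\mathbf v_1)<F_\beta(\mathbf u_2)$ for $\beta_{s,2}\le\beta<\beta_3$ and $F_\beta(\mathbf v_1)>F_\beta(\mathbf u_2)$ for $\beta_3<\beta\le q$). For $\beta>\beta_1$ put $H_\beta=F_\beta(\mathbf v_1)$ for $\beta\in(\beta_1,\beta_3)$ and $H_\beta=F_\beta(\mathbf u_2)$ for $\beta\in[\beta_3,\infty)$. Let $\widehat S=S\cup\{\mathfrak o\}$. For $k\in S$, $\mathcal W_k$ is the connected component of $\{F_\beta<H_\beta\}\subset\Xi$ containing $\mathbf u_1^k$, and $\mathcal W_{\mathfrak o}$ is the connected component of $\{F_\beta<F_\beta(\mathbf v_1)\}\subset\Xi$ containing $\mathbf p$ (each taken to be empty if the indicated point is not in the indicated sublevel set). For distinct $k,l\in\widehat S$, $\Sigma_{k,l}=\overline{\mathcal W_k}\cap\overline{\mathcal W_l}$. *)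

(* Defs.v *)
From mathcomp Require Import all_boot all_order all_algebra.
From mathcomp Require Import all_classical all_reals all_analysis.

Set Implicit Arguments.
Unset Strict Implicit.
Unset Printing Implicit Defensive.

Import Order.TTheory GRing.Theory Num.Theory.
Import numFieldNormedType.Exports.

Local Open Scope classical_set_scope.
Local Open Scope ring_scope.

(* Spins 1, ..., q are numbered 0, ..., q - 1, so the eliminated coordinate
   x_q = 1 - x_1 - ... - x_(q-1) is the one of index q.-1. *)

Definition Xi (R : realType) (q : nat) : set 'rV[R]_q.-1 :=
  [set x | (forall j, 0 <= x 0 j) /\ \sum_j x 0 j <= 1].

Definition coord (R : realType) (q : nat) (x : 'rV[R]_q.-1) (k : 'I_q) : R :=
  if (insub (k : nat) : option 'I_q.-1) is Some j then x 0 j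
  else 1 - \sum_j x 0 j.

(* [ln 0 = 0] in the library, and 0 * ln 0 = 0 as required. *)
Definition F (R : realType) (q : nat) (b : R) (x : 'rV[R]_q.-1) : R :=
  - (2^-1 * \sum_(k < q) coord x k ^+ 2)
  + b^-1 * \sum_(k < q) (coord x k * ln (coord x k)).

Definition sublevel (R : realType) (q : nat) (b h : R) : set 'rV[R]_q.-1 :=
  [set x | Xi x /\ F b x < h].

Arguments sublevel {R} q b h _.

Definition gdom (R : realType) (q i : nat) : set R :=
  [set t | 0 < t < (q - i)%N%:R^-1].

Definition g (R : realType) (q i : nat) (t : R) : R :=
  if t == q%:R^-1 then q%:R
  else i%:R / (1 - q%:R * t) * ln ((1 - (q - i)%N%:R * t) / (i%:R * t)).

(* The infimum is a minimum for 1 <= i <= q / 2. *)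
Definition beta_s (R : realType) (q i : nat) : R :=
  inf [set g q i t | t in @gdom R q i].

(* For b >= beta_s R q i there are one or two solutions: the infimum and the
   supremum of the solution set are its smallest and largest elements. *)
Definition gsol (R : realType) (q i : nat) (b : R) : set R :=
  [set t | @gdom R q i t /\ g q i t = b].

Definition u (R : realType) (q i : nat) (b : R) : R := inf (gsol q i b).

Definition v (R : realType) (q i : nat) (b : R) : R := sup (gsol q i b).

(* The point with full coordinates c 0, ..., c q.-1, when these sum to 1. *)
Definition point_of (R : realType) (q : nat) (c : nat -> R) : 'rV[R]_q.-1 :=
  \row_(j < q.-1) c j.

Definition pp (R : realType) (q : nat) : 'rV[R]_q.-1 :=
  point_of q (fun=> q%:R^-1).

Definition pt1 (R : realType) (q : nat) (t : R) (k : nat) : 'rV[R]_q.-1 :=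
  point_of q (fun m => if m == k then 1 - (q - 1)%N%:R * t else t).

Definition pt2 (R : realType) (q : nat) (t : R) (k l : nat) : 'rV[R]_q.-1 :=
  point_of q (fun m => if (m == k) || (m == l)
                       then (1 - (q - 2)%N%:R * t) / 2 else t).

Definition u1pt (R : realType) (q : nat) (b : R) (k : nat) : 'rV[R]_q.-1 :=
  pt1 q (u q 1 b) k.

Definition v1pt (R : realType) (q : nat) (b : R) (k : nat) : 'rV[R]_q.-1 :=
  pt1 q (v q 1 b) k.

Definition u2pt (R : realType) (q : nat) (b : R) (k l : nat) : 'rV[R]_q.-1 :=
  pt2 q (u q 2 b) k l.

Definition U1 (R : realType) (q : nat) (b : R) : set 'rV[R]_q.-1 :=
  [set u1pt q b k | k in [set: 'I_q]].

Definition V1 (R : realType) (q : nat) (b : R) : set 'rV[R]_q.-1 :=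
  [set v1pt q b k | k in [set: 'I_q]].

Arguments U1 {R} q b _.
Arguments V1 {R} q b _.

Definition v1 (R : realType) (q : nat) (b : R) : 'rV[R]_q.-1 :=
  v1pt q b q.-1.

Definition u2 (R : realType) (q : nat) (b : R) : 'rV[R]_q.-1 :=
  u2pt q b q.-2 q.-1.

Definition beta1 (R : realType) (q : nat) : R := beta_s R q 1.

Definition beta3_eqn (R : realType) (q : nat) (b : R) : Prop :=
  beta_s R q 2 < b < q%:R /\ F b (v1 q b) = F b (u2 q b).

(* The default value q makes [beta3 R q < q%:R] equivalent to the existence of
   a unique solution of [beta3_eqn]. *)
Definition beta3 (R : realType) (q : nat) : R :=
  xget q%:R [set b | unique (@beta3_eqn R q) b].

Definition H (R : realType) (q : nat) (b : R) : R :=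
  if b < beta3 R q then F b (v1 q b) else F b (u2 q b).

(* [None] is the extra index o.  [connected_component A x] is empty when x is
   not in A. *)
Definition W (R : realType) (q : nat) (b : R) (k : option 'I_q) :
    set 'rV[R]_q.-1 :=
  match k with
  | Some k => connected_component (sublevel q b (H q b)) (u1pt q b k)
  | None => connected_component (sublevel q b (F b (v1 q b))) (pp R q)
  end.

Definition Sigma (R : realType) (q : nat) (b : R) (k l : option 'I_q) :
    set 'rV[R]_q.-1 :=
  closure (W b k) `&` closure (W b l).

Definition components (T : topologicalType) (A : set T) : set (set T) :=
  [set connected_component A x | x in A].

(* Main.v *)
Require Import Defs.
From mathcomp Require Import all_boot all_order all_algebra.
From mathcomp Require Import all_classical all_reals all_analysis.
From mathcomp Require Import zify ring lra.
Import Order.TTheory GRing.Theory Num.Theory.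
Import numFieldNormedType.Exports.
Local Open Scope classical_set_scope.
Local Open Scope ring_scope.

(* [F b x] is the sum over the coordinates of [phi b], whose derivative is
   [b^-1 * (kappa b y + 1)] with [kappa b y = ln y - b * y] increasing up to
   [b^-1] and decreasing after it. So moving mass from a coordinate to another
   one of smaller [kappa] lowers the energy, and at a critical point all
   coordinates have the same [kappa], hence at most two values.

   The wells are separated by explicit hypersurfaces. On the face where the
   largest coordinate equals that of [v1], the tangent line of [phi b] at the
   small coordinate of [v1] gives F >= F(v1), with equality only at the points of
   V1. Where the largest coordinate is attained at both k and l, above that
   height, a minimiser of F either lies at that height or is of the form
   (S, S, T, ..., T), so that F >= F(u2) there. Conversely, from u2 the pair
   (S, S) can be spread to (S + r, S - r), with decreasing energy, down to the
   line carrying u1 and v1, which gives the closure points. Finally a component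
   of a sublevel set contains its minimiser, which is p or some u1.

   For the critical temperature, b * F b x is affine in b for fixed x, while
   F(u2) is a minimum and F(v1) a maximum along a line; thus
   b * (F(u2) - F(v1)) is concave in b, positive at beta_{s,2} and negative at
   q, and has exactly one zero in between. *)

(* [all_algebra] hides the coordinates of [Defs] behind those of [vector]. *)
Local Notation coord := Defs.coord.

Set Implicit Arguments.
Unset Strict Implicit.
Unset Printing Implicit Defensive.

(** * The energy of one site *)

(** The functions g_i enter through the sign of a derivative: on the line of points with i equal
    coordinates and the q - i others equal to t < 1/q, the slope of F has the sign of b - g_i(t).
    Hence, for b between beta_{s,i} and q, u_i and v_i are a local minimum and a local maximum on
    that line. The logarithm makes the slope of F infinite on the boundary of Xi. So finite amounts
    of mass are moved between two or three coordinates and mean values of kappa are compared: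
    boundary and interior points are treated alike, second derivatives are avoided, and the
    inequalities come out strict, which is what reduces the intersections of closures to single
    points. The two families of critical points are linked by spreading the pair of u2: this shows
    that u_2 exceeds u_1, and is below v_1 when b < q, whence beta_{s,1} <= beta_{s,2} and a path
    from u2 down to u1. *)

Lemma mean_value (R : realType) (f df : R -> R) (a b : R) : a < b ->
  (forall x, a < x < b -> is_derive x 1 f (df x)) ->
  (forall x, a <= x <= b -> {for x, continuous f}) ->
  exists2 c, a < c < b & f b - f a = df c * (b - a).
Proof.
move=> ab fd fc.
have fd' x : x \in `]a, b[ -> is_derive x 1 f (df x) by rewrite in_itv => /fd.
have fc' : {within `[a, b], continuous f}.
  by apply/continuous_in_subspaceT => x; rewrite inE /= in_itv /=; exact: fc.
have [c cab E] := MVT ab fd' fc'.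
by exists c => //; move: cab; rewrite in_itv.
Qed.

Lemma lt_of_deriv_gt0 (R : realType) (f df : R -> R) (a b : R) : a < b ->
  (forall x, a < x < b -> is_derive x 1 f (df x)) ->
  (forall x, a <= x <= b -> {for x, continuous f}) ->
  (forall x, a < x < b -> 0 < df x) -> f a < f b.
Proof.
move=> ab fd fc d0; have [c cab E] := mean_value ab fd fc.
by rewrite -subr_gt0 E mulr_gt0 ?d0// subr_gt0.
Qed.

Lemma lt_of_deriv_lt0 (R : realType) (f df : R -> R) (a b : R) : a < b ->
  (forall x, a < x < b -> is_derive x 1 f (df x)) ->
  (forall x, a <= x <= b -> {for x, continuous f}) ->
  (forall x, a < x < b -> df x < 0) -> f b < f a.
Proof.
move=> ab fd fc d0; have [c cab E] := mean_value ab fd fc.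
by rewrite -subr_lt0 E nmulr_rlt0 ?d0// subr_gt0.
Qed.

Lemma is_derive_continuous (R : realType) (f : R -> R) (x d : R) :
  is_derive x 1 f d -> {for x, continuous f}.
Proof.
by move=> df; apply: differentiable_continuous; apply/derivable1_diffP; case: df.
Qed.

Lemma lt_of_is_derive_gt0 (R : realType) (f df : R -> R) (a b : R) : a < b ->
  (forall x, a <= x <= b -> is_derive x 1 f (df x)) ->
  (forall x, a < x < b -> 0 < df x) -> f a < f b.
Proof.
move=> ab fd; apply: lt_of_deriv_gt0 => // x xab.
  by apply: fd; case/andP: xab => ? ?; apply/andP; split; exact: ltW.
exact: is_derive_continuous (fd x xab).
Qed.

Lemma lt_of_is_derive_lt0 (R : realType) (f df : R -> R) (a b : R) : a < b ->
  (forall x, a <= x <= b -> is_derive x 1 f (df x)) ->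
  (forall x, a < x < b -> df x < 0) -> f b < f a.
Proof.
move=> ab fd; apply: lt_of_deriv_lt0 => // x xab.
  by apply: fd; case/andP: xab => ? ?; apply/andP; split; exact: ltW.
exact: is_derive_continuous (fd x xab).
Qed.

(** [ln (sqrt x) <= sqrt x - 1], doubled. The bound tames x ln x at 0 and, later, the logarithm in
    g_i near 0. *)
Lemma ln_lt_sqrt (R : realType) (x : R) : 0 < x -> ln x < 2 * Num.sqrt x.
Proof.
move=> x0; have s0 : 0 < Num.sqrt x by rewrite sqrtr_gt0.
have -> : ln x = 2 * ln (Num.sqrt x).
  by rewrite mulr_natl -lnXn// sqr_sqrtr// ltW.
have h : -1 < Num.sqrt x - 1 by lra.
have := le_ln1Dx h; rewrite addrC subrK => h'.
by rewrite ltr_pM2l//; lra.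
Qed.

Lemma xlnx_abs (R : realType) (x : R) : 0 < x -> x < 1 -> `|x * ln x| < 2 * Num.sqrt x.
Proof.
move=> x0 x1; have s0 : 0 < Num.sqrt x by rewrite sqrtr_gt0.
rewrite ler0_norm; last by rewrite mulr_ge0_le0 ?ltW// ln_lt0// x0.
have xi : 0 < x^-1 by rewrite invr_gt0.
have := ln_lt_sqrt xi; rewrite lnV ?posrE// sqrtrV ?ltW// => h.
rewrite -mulrN -(ltr_pM2l xi) mulrA mulVf ?gt_eqF// mul1r.
apply: lt_le_trans h _.
rewrite -{2}(sqr_sqrtr (ltW x0)).
suff -> : Num.sqrt x ^- 2 * (2 * Num.sqrt x) = 2 * (Num.sqrt x)^-1 by [].
by field; rewrite gt_eqF.
Qed.

Lemma continuous_xlnx (R : realType) : continuous (fun x : R => x * ln x).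
Proof.
move=> x; have [x0|x0|->] := ltgtP x 0.
- apply: (@near_cst_continuous _ _ 0).
  near=> y; rewrite ln0 ?mulr0//.
  by apply: ltW; near: y; exact: lt_nbhsl.
- by apply: cvgM; [exact: cvg_id|exact: continuous_ln].
- apply/cvgrPdist_lt => e e0; rewrite mul0r.
  (* [(e / 2) ^+ 2] is what makes [2 * sqrt y < e]; the bound 1 is a hypothesis of [xlnx_abs]. *)
  have d0 : 0 < Num.min 1 ((e / 2) ^+ 2) by rewrite lt_min ltr01 exprn_gt0// divr_gt0.
  near=> y; rewrite sub0r normrN.
  have yd : `|y| < Num.min 1 ((e / 2) ^+ 2).
    near: y; apply/nbhs_ballP; exists (Num.min 1 ((e / 2) ^+ 2)) => // z.
    by rewrite /ball /= sub0r normrN.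
  have [y0|y0] := leP y 0; first by rewrite ln0// mulr0 normr0.
  move: yd; rewrite gtr0_norm// lt_min => /andP[y1 ye].
  apply: lt_trans (xlnx_abs y0 y1) _.
  have e2 : 0 <= e / 2 by rewrite divr_ge0 ?ltW.
  have : Num.sqrt y < e / 2.
    by rewrite -(ger0_norm e2) -sqrtr_sqr ltr_sqrt// exprn_gt0// divr_gt0.
  lra.
Unshelve. all: by end_near. Qed.

Section energy.
Context {R : realType}.
Implicit Types b x y : R.

Definition phi b y := - (2^-1 * y ^+ 2) + b^-1 * (y * ln y).
Definition kappa b y := ln y - b * y.

Lemma continuous_phi b : continuous (phi b).
Proof.
move=> y; apply: cvgD.
  by apply: cvgN; apply: cvgMr; apply: exprn_continuous.
by apply: cvgMr; exact: continuous_xlnx.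
Qed.

Lemma is_derive_kappa b y : 0 < y -> is_derive y 1 (kappa b) (y^-1 - b).
Proof.
move=> y0; have h := is_derive1_ln y0.
rewrite /kappa; apply: is_derive_eq.
by rewrite /GRing.scale /= mulr1.
Qed.

Lemma is_derive_phi b y : 0 < b -> 0 < y ->
  is_derive y 1 (phi b) (b^-1 * (kappa b y + 1)).
Proof.
move=> b0 y0; have h := is_derive1_ln y0.
rewrite /phi/kappa; apply: is_derive_eq.
rewrite /= ?scaler0 ?addr0 ?mulr1 /GRing.scale /=.
by field; rewrite !gt_eqF.
Qed.

Lemma kappa_incr b x y : 0 < b -> 0 < x -> x < y -> y <= b^-1 ->
  kappa b x < kappa b y.
Proof.
move=> b0 x0 xy yb.
apply: (@lt_of_is_derive_gt0 _ _ (fun z => z^-1 - b)) => // z /andP[xz zy].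
  by apply: is_derive_kappa; lra.
by rewrite subr_gt0 -ltf_pV2 ?posrE ?invrK ?invr_gt0//; lra.
Qed.

Lemma kappa_decr b x y : 0 < b -> b^-1 <= x -> x < y ->
  kappa b y < kappa b x.
Proof.
move=> b0 xb xy; have bi : 0 < b^-1 by rewrite invr_gt0.
apply: (@lt_of_is_derive_lt0 _ _ (fun z => z^-1 - b)) => // z /andP[xz zy].
  by apply: is_derive_kappa; lra.
by rewrite subr_lt0 -ltf_pV2 ?posrE ?invrK ?invr_gt0//; lra.
Qed.

(** [kappa b] increases and then decreases, so it is strictly quasiconcave. *)
Lemma kappa_mid b x z y : 0 < b -> 0 < x -> x < z -> z < y ->
  kappa b x < kappa b z \/ kappa b y < kappa b z.
Proof.
move=> b0 x0 xz zy; have [zb|/ltW zb] := leP z b^-1.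
  by left; exact: kappa_incr.
by right; exact: kappa_decr.
Qed.

(** The end point 0 is allowed: [phi b] is continuous there, although its slope is infinite. *)
Lemma phi_mean_value b x y : 0 < b -> 0 <= x -> x < y ->
  exists2 c, x < c < y & phi b y - phi b x = b^-1 * (kappa b c + 1) * (y - x).
Proof.
move=> b0 x0 xy.
have phid z : x < z < y -> is_derive z 1 (phi b) (b^-1 * (kappa b z + 1)).
  by move=> /andP[xz zy]; apply: is_derive_phi b0 _; exact: le_lt_trans xz.
have phic z : x <= z <= y -> {for z, continuous (phi b)}.
  by move=> _; exact: continuous_phi.
exact: (mean_value xy phid phic).
Qed.

(** [m] coordinates gain [r] each and [n] lose [r'] each; [m * r = n * r'] conserves the mass. The
    sign of the change is read off the mean slopes over the two ranges. *)
Lemma phi_exchange b x y r r' m n : 0 < b -> 0 <= x -> 0 < r -> 0 < r' ->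
  r' <= y -> 0 < m -> m * r = n * r' ->
  (forall z w, x < z < x + r -> y - r' < w < y -> kappa b z < kappa b w) ->
  m * phi b (x + r) + n * phi b (y - r') < m * phi b x + n * phi b y.
Proof.
move=> b0 x0 r0 r'0 r'y m0 E h.
have [|z zI Ez] := @phi_mean_value b x (x + r) b0 x0; first lra.
have [||w wI Ew] := @phi_mean_value b (y - r') y b0; [lra|lra|].
have := h _ _ zI wI => zw.
have bi : 0 < b^-1 by rewrite invr_gt0.
have E1 : m * (phi b (x + r) - phi b x) = b^-1 * (kappa b z + 1) * (m * r).
  by rewrite Ez; ring.
have E2 : n * (phi b y - phi b (y - r')) = b^-1 * (kappa b w + 1) * (m * r).
  by rewrite Ew E; ring.
have : b^-1 * (kappa b z + 1) * (m * r) < b^-1 * (kappa b w + 1) * (m * r).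
  by rewrite ltr_pM2r ?mulr_gt0// ltr_pM2l// ltrD2r.
by rewrite -E1 -E2 !mulrBr; lra.
Qed.

Lemma kappa_continuous b x : 0 < x -> {for x, continuous (kappa b)}.
Proof. by move=> x0; exact: is_derive_continuous (is_derive_kappa b x0). Qed.

(** Continuity spreads a strict inequality of potentials to neighbourhoods, as [phi_exchange]
    requires. At [x = 0] the inequality comes from the limit -oo of kappa at 0. *)
Lemma kappa_gap b x y : 0 < b -> 0 <= x -> 0 < y ->
  (x = 0 \/ kappa b x < kappa b y) ->
  exists2 e, 0 < e & forall z w, 0 < z -> `|x - z| < e -> `|y - w| < e ->
    kappa b z < kappa b w.
Proof.
move=> b0 x0 y0 xy.
have gap c : c < kappa b y -> exists2 e, 0 < e &
    forall w, `|y - w| < e -> c < kappa b w.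
  move=> cy; have := @kappa_continuous b _ y0.
  move=> /cvgrPdist_lt /(_ (kappa b y - c)); rewrite subr_gt0 => /(_ cy).
  move=> /nbhs_ballP[e /= e0 he]; exists e => // w /he.
  by rewrite /= ltr_norml => /andP[_]; lra.
have [x00|xn] := eqVneq x 0.
  have [|e e0 he] := gap (kappa b y - 1); first lra.
  (* A positive [z] below this exponential has [ln z < kappa b y - 1], which is below the potential
     of every [w] near [y]. *)
  exists (Num.min e (expR (kappa b y - 1))); first by rewrite lt_min e0 expR_gt0.
  move=> z w z0; rewrite x00 sub0r normrN gtr0_norm// !lt_min.
  move=> /andP[_ zK] /andP[we _]; apply: lt_trans (he _ we).
  have : ln z < kappa b y - 1.
    by rewrite -(expRK (kappa b y - 1)) ltr_ln ?posrE ?expR_gt0.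
  by have := mulr_gt0 b0 z0; rewrite {2}/kappa; lra.
have xp : 0 < x by rewrite lt_def xn.
have {}xy : kappa b x < kappa b y by case: xy => // xz; rewrite xz eqxx in xn.
pose c := (kappa b x + kappa b y) / 2.
have [|e e0 he] := gap c; first by rewrite /c; lra.
have := @kappa_continuous b _ xp.
move=> /cvgrPdist_lt /(_ (c - kappa b x)) []; first by rewrite /c; lra.
move=> e' /= e'0 he'.
exists (Num.min e e'); first by rewrite lt_min e0.
move=> z w z0; rewrite !lt_min => /andP[_ /he' /=] zx /andP[/he yw _].
by apply: lt_trans yw; move: zx; rewrite ltr_norml => /andP[]; lra.
Qed.

End energy.

(** * Coordinates, segments and minimisers *)

Section coordinates.
Context {R : realType}.

Lemma closure_le (T : topologicalType) (f g : T -> R) (A : set T) (x : T) :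
  {for x, continuous f} -> {for x, continuous g} ->
  (forall y, A y -> f y <= g y) -> closure A x -> f x <= g x.
Proof.
move=> fc gc fg Ax; rewrite leNgt; apply/negP => gf.
have fgc : {for x, continuous (fun y => f y - g y)} by exact: cvgB.
have d0 : 0 < f x - g x by rewrite subr_gt0.
move/cvgrPdist_lt: fgc => /(_ _ d0) /= h.
have [y [Ay /=]] := Ax _ h.
have := fg _ Ay; rewrite ltr_norml => ? /andP[? ?]; lra.
Qed.

Lemma continuous_sum (T : topologicalType) (I : Type) (r : seq I)
    (f : I -> T -> R) (x : T) : (forall i, {for x, continuous (f i)}) ->
  {for x, continuous (fun y => \sum_(i <- r) f i y)}.
Proof.
move=> fc; elim: r => [|i r IH].
  rewrite (_ : (fun _ => _) = fun=> 0); first exact: cvg_cst.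
  by apply/funext => y; rewrite big_nil.
rewrite (_ : (fun _ => _) = fun y => f i y + \sum_(i <- r) f i y).
  exact: cvgD (fc i) IH.
by apply/funext => y; rewrite big_cons.
Qed.

(** In the applications [U] is given by strict inequalities and [V] by the weak ones. The connected
    set avoids the difference, so it cannot leave [U]. *)
Lemma connected_clopen (T : topologicalType) (A U V : set T) (x : T) :
  connected A -> open U -> closed V -> A `&` U `<=` V -> A `&` V `<=` U ->
  A x -> U x -> A `<=` U.
Proof.
move=> Ac Uo Vc UV VU Ax Ux.
suff <- : A `&` U = A by move=> y [].
apply: Ac; first by exists x.
  by exists U.
exists V => //; apply/seteqP; split=> y [Ay h]; split=> //.
  by apply: UV; split.
by apply: VU; split.
Qed.

Lemma segment_continuous n (x d : 'rV[R]_n) : continuous (fun r : R => x + r *: d).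
Proof. by move=> r; apply: cvgD; [exact: cvg_cst|exact: scalel_continuous]. Qed.

Lemma segment_component n (A : set 'rV[R]_n) (x y : 'rV[R]_n) :
  (forall r, 0 <= r <= 1 -> A (x + r *: (y - x))) -> connected_component A x y.
Proof.
move=> h; pose P r := x + r *: (y - x).
apply: (@connected_component_max _ A (P @` `[0, 1])).
- by exists 0; rewrite /P ?scale0r ?addr0//= in_itv /= lexx ler01.
- by move=> _ [r rI <-]; apply: h; move: rI; rewrite /= in_itv.
- apply: connected_continuous_connected.
    by apply/connected_intervalP; exact: interval_is_interval.
  by apply: continuous_subspaceT => r; exact: segment_continuous.
- by exists 1; rewrite /P ?scale1r ?[y - x]addrC ?addNKr//= in_itv /= lexx ler01.
Qed.

Lemma segment_closure n (B : set 'rV[R]_n) (x y : 'rV[R]_n) :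
  (forall r, 0 < r <= 1 -> B (x + r *: (y - x))) -> closure B x.
Proof.
move=> h C xC.
have := @segment_continuous n x (y - x) 0.
rewrite /continuous_at scale0r addr0 => /(_ _ xC) /nbhs_ballP[e /= e0 he].
exists (x + (Num.min (e / 2) 1) *: (y - x)); split.
  by apply: h; rewrite lt_min ltr01 divr_gt0//= ge_min lexx orbT.
apply: he; rewrite /ball /= sub0r normrN.
rewrite ger0_norm ?le_min ?ler01 ?divr_ge0 ?ltW//.
by rewrite gt_min ltr_pdivrMr// ltr_pMr// ltr1n.
Qed.

Variable q : nat.
Hypothesis q0 : (0 < q)%N.
Implicit Types x y : 'rV[R]_q.-1.

Definition lift_ord (j : 'I_q.-1) : 'I_q := widen_ord (leq_pred q) j.

Lemma coord_lift x j : coord x (lift_ord j) = x 0 j.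
Proof. by rewrite /coord /= (valK j). Qed.

Lemma sum_ord_last (c : 'I_q -> R) :
  \sum_k c k = \sum_(j < q.-1) c (lift_ord j) +
    c (Ordinal (etrans (f_equal (fun m => q.-1 < m)%N (esym (prednK q0)))
                 (ltnSn q.-1))).
Proof.
rewrite /lift_ord; case: q q0 c => // n n0 c; rewrite big_ord_recr /=.
by congr (_ + c _); [apply: eq_bigr => j _; congr c|]; exact: val_inj.
Qed.

Lemma coord_last x (k : 'I_q) : k = q.-1 :> nat ->
  coord x k = 1 - \sum_j x 0 j.
Proof. by move=> kq; rewrite /coord insubF// kq ltnn. Qed.

Lemma coord_sum x : \sum_k coord x k = 1.
Proof.
rewrite sum_ord_last [X in _ + X]coord_last//.
by under eq_bigr do rewrite coord_lift; rewrite addrC subrK.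
Qed.

Lemma ord_last_or (k : 'I_q) : k = q.-1 :> nat \/ exists j, k = lift_ord j.
Proof.
have [kq|kq] := ltnP k q.-1.
  by right; exists (Ordinal kq); exact: val_inj.
left; apply/eqP; rewrite eqn_leq kq andbT.
by rewrite -ltnS prednK.
Qed.

Lemma coord_inj x y : (forall k, coord x k = coord y k) -> x = y.
Proof. by move=> h; apply/rowP => j; rewrite -!coord_lift. Qed.

Lemma XiP x : Xi x <-> forall k, 0 <= coord x k.
Proof.
split=> [[h0 h1] k|h].
  have [kq|[j ->]] := ord_last_or k; last by rewrite coord_lift.
  by rewrite coord_last// subr_ge0.
split=> [j|]; first by rewrite -coord_lift.
have := h (Ordinal (etrans (f_equal (fun m => q.-1 < m)%N (esym (prednK q0)))
                 (ltnSn q.-1))).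
by rewrite coord_last// subr_ge0.
Qed.

Definition of_coords (c : 'I_q -> R) : 'rV[R]_q.-1 := \row_j c (lift_ord j).

Lemma coord_of_coords c : \sum_k c k = 1 -> coord (of_coords c) =1 c.
Proof.
move=> c1 k; have [kq|[j ->]] := ord_last_or k; last by rewrite coord_lift mxE.
rewrite coord_last//; under eq_bigr do rewrite mxE.
rewrite -c1 (sum_ord_last c) [X in X - _]addrC addrK.
by congr c; exact: val_inj.
Qed.

Lemma coord_point_of (c : nat -> R) : \sum_(k < q) c k = 1 ->
  forall k : 'I_q, coord (point_of q c) k = c k.
Proof.
move=> c1 k; exact: (coord_of_coords (c := c \o val)).
Qed.

Lemma coord_segment x y r k :
  coord (x + r *: (y - x)) k = coord x k + r * (coord y k - coord x k).
Proof.
have [kq|[j ->]] := ord_last_or k; last by rewrite !coord_lift !mxE.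
rewrite !coord_last// (eq_bigr (fun j => x 0 j + r * (y 0 j - x 0 j))); last first.
  by move=> j _; rewrite !mxE.
rewrite big_split -mulr_sumr /= sumrB; ring.
Qed.

Lemma continuous_coord (k : 'I_q) :
  continuous (fun x : 'rV[R]_q.-1 => coord x k).
Proof.
move=> x; rewrite /coord; case: insub => [j|]; first exact: coord_continuous.
have h : {for x, continuous (fun y : 'rV[R]_q.-1 => \sum_j y 0 j)}.
  by apply: continuous_sum => j; exact: coord_continuous.
exact: (cvgB (cvg_cst _) h).
Qed.

Lemma F_sum b x : F b x = \sum_k phi b (coord x k).
Proof. by rewrite /phi big_split /= sumrN -!mulr_sumr. Qed.

Lemma continuous_F b : continuous (@F R q b).
Proof.
move=> x; rewrite (_ : F b = fun y => \sum_k phi b (coord y k)).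
  apply: continuous_sum => k.
  apply: (@continuous_comp _ _ _ (fun x => coord x k) (phi b)).
    exact: continuous_coord.
  exact: continuous_phi.
by apply/funext => y; exact: F_sum.
Qed.

Lemma closed_Xi : closed (@Xi R q).
Proof.
move=> x Ax; apply/XiP => k.
have h0 : {for x, continuous (fun _ : 'rV[R]_q.-1 => 0 : R)}
  by move=> B; exact: (@cst_continuous 'rV[R]_q.-1 R 0 x B).
apply: (closure_le h0 (@continuous_coord k x) _ Ax) => y Xy.
by move/XiP: Xy; exact.
Qed.

Lemma coord_le1 x k : Xi x -> coord x k <= 1.
Proof.
move=> /XiP h; rewrite -(coord_sum x) (bigD1 k)//= lerDl.
by apply: sumr_ge0 => j _; exact: h.
Qed.

Lemma compact_Xi : compact (@Xi R q).
Proof.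
apply: (@subclosed_compact _ _ [set v : 'rV[R]_q.-1 | forall i, `[0, 1]%classic (v ord0 i)]).
- exact: closed_Xi.
- by apply: (@rV_compact R q.-1 (fun=> `[0, 1]%classic)) => i; exact: segment_compact.
- move=> x Xx i; rewrite /= in_itv /= -coord_lift coord_le1// andbT.
  by move/XiP: Xx; exact.
Qed.

Lemma F_min (b : R) (A : set 'rV[R]_q.-1) : closed A -> A `<=` @Xi R q ->
  A !=set0 -> exists2 x, A x & forall y, A y -> F b x <= F b y.
Proof.
move=> Ac AX A0.
have Ak : compact A by apply: subclosed_compact Ac compact_Xi AX.
have [|x xA h] := EVT_min_rV A0 Ak (f := F b).
  by apply: continuous_subspaceT => x; exact: continuous_F.
exists x; first by rewrite inE in xA.
by move=> y Ay; apply: h; rewrite inE.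
Qed.

Lemma sum_split2 (f : 'I_q -> R) (k l : 'I_q) : k != l ->
  \sum_m f m = f k + f l + \sum_(m | (m != k) && (m != l)) f m.
Proof.
move=> kl; rewrite (bigD1 k)//= (bigD1 l)/=; last by rewrite eq_sym.
by rewrite addrA.
Qed.

Lemma sum_split3 (f : 'I_q -> R) (k l a : 'I_q) : k != l -> a != k -> a != l ->
  \sum_m f m =
  f k + f l + f a + \sum_(m | [&& m != k, m != l & m != a]) f m.
Proof.
move=> kl ak al; rewrite (sum_split2 _ kl) (bigD1 a)/=; last by rewrite ak.
by rewrite addrA; under eq_bigl do rewrite -andbA.
Qed.

Lemma F_pair b x y (k l : 'I_q) : k != l ->
  (forall m, m != k -> m != l -> coord y m = coord x m) ->
  F b y - F b x = phi b (coord y k) + phi b (coord y l)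
                - (phi b (coord x k) + phi b (coord x l)).
Proof.
move=> kl h; rewrite !F_sum (sum_split2 (fun m => phi b (coord x m)) kl).
rewrite (sum_split2 (fun m => phi b (coord y m)) kl).
rewrite (eq_bigr (fun m => phi b (coord x m))); first by ring.
by move=> m /andP[? ?]; rewrite h.
Qed.

Lemma F_triple b x y (k l a : 'I_q) : k != l -> a != k -> a != l ->
  (forall m, m != k -> m != l -> m != a -> coord y m = coord x m) ->
  F b y - F b x =
    phi b (coord y k) + phi b (coord y l) + phi b (coord y a)
    - (phi b (coord x k) + phi b (coord x l) + phi b (coord x a)).
Proof.
move=> kl ak al h; rewrite !F_sum.
rewrite (sum_split3 (fun m => phi b (coord x m)) kl ak al).
rewrite (sum_split3 (fun m => phi b (coord y m)) kl ak al).
rewrite (eq_bigr (fun m => phi b (coord x m))); first by ring.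
by move=> m /and3P[? ? ?]; rewrite h.
Qed.

End coordinates.

(** * The shape of the functions g_i *)

Section shape_of_g.
Context {R : realType}.
(** These stand for i, q - i and q; as abstract reals they are atoms for [lra] and [field]. *)
Variables I J Q : R.
Hypothesis IJQ_ : [/\ 1 <= I, I < J & I + J = Q].

Let IJQ5 : [/\ 1 <= I, I < J, I + J = Q, 0 < J & 0 < Q].
Proof. by case: IJQ_ => I1 IJ E; split=> //; lra. Qed.

Let QJ : Q^-1 < J^-1.
Proof.
have [I1 IJ IJQ J0 Q0] := IJQ5.
by rewrite ltf_pV2 ?posrE; lra. Qed.

Let JtI t : t < J^-1 -> 0 < 1 - J * t.
Proof.
have [I1 IJ IJQ J0 Q0] := IJQ5.
by move=> h; rewrite subr_gt0 mulrC -ltr_pdivlMr// div1r. Qed.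

Let QtP t : t < Q^-1 -> 0 < 1 - Q * t.
Proof.
have [I1 IJ IJQ J0 Q0] := IJQ5.
by move=> h; rewrite subr_gt0 mulrC -ltr_pdivlMr// div1r. Qed.

Let QtN t : Q^-1 < t -> 1 - Q * t < 0.
Proof.
have [I1 IJ IJQ J0 Q0] := IJQ5.
by move=> h; rewrite subr_lt0 mulrC -ltr_pdivrMr// div1r. Qed.

Let JtQ t : Q^-1 <= t -> 2^-1 < J * t.
Proof.
have [I1 IJ IJQ J0 Q0] := IJQ5.
move=> h; apply: (@lt_le_trans _ _ (J * Q^-1)); last by rewrite ler_pM2l.
by rewrite ltr_pdivlMr//; lra.
Qed.

Let half_lt : (2 * J)^-1 < Q^-1.
Proof.
have [I1 IJ IJQ J0 Q0] := IJQ5.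
by rewrite ltf_pV2 ?posrE; lra. Qed.

Let Jt2 t : (2 * J)^-1 < t -> 2^-1 < J * t.
Proof.
have [I1 IJ IJQ J0 Q0] := IJQ5.
move=> h; have : J * (2 * J)^-1 < J * t by rewrite ltr_pM2l.
suff -> : J * (2 * J)^-1 = 2^-1 by [].
by field; rewrite gt_eqF.
Qed.

Let Jt2' t : t < (2 * J)^-1 -> J * t < 2^-1.
Proof.
have [I1 IJ IJQ J0 Q0] := IJQ5.
move=> h; have : J * t < J * (2 * J)^-1 by rewrite ltr_pM2l.
suff -> : J * (2 * J)^-1 = 2^-1 by [].
by field; rewrite gt_eqF.
Qed.

Definition log_ratio t := ln (1 - J * t) - ln (I * t).
(** The part of the derivative of [gval] that carries its sign, see [gval_deriv]. *)
Definition slope t := Q * log_ratio t - (1 - Q * t) / (t * (1 - J * t)).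
Definition gval t := I / (1 - Q * t) * log_ratio t.

Let one_sub_deriv (a x : R) : is_derive x 1 (fun y : R => 1 - a * y) (- a).
Proof. by apply: is_derive_eq; rewrite /GRing.scale /=; ring. Qed.

Let ln_comp_deriv (f : R -> R) (x d : R) : 0 < f x -> is_derive x 1 f d ->
  is_derive x 1 (fun y => ln (f y)) (d / f x).
Proof.
move=> fx fd; have h := is_derive1_ln fx.
have := @is_derive1_comp R (@ln R) f x (f x)^-1 d h fd.
by rewrite mulrC.
Qed.

Lemma log_ratio_deriv t : 0 < t -> t < J^-1 ->
  is_derive t 1 log_ratio (- (t * (1 - J * t))^-1).
Proof.
have [I1 IJ IJQ J0 Q0] := IJQ5.
move=> t0 tJ; have Jt := JtI tJ.
have d1 := one_sub_deriv J t.
have d2 : is_derive t 1 (fun t : R => I * t) I.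
  by apply: is_derive_eq; rewrite /GRing.scale /= mulr1.
have It : 0 < I * t by rewrite mulr_gt0//; lra.
have := is_deriveB (@ln_comp_deriv (fun y => 1 - J * y) _ _ Jt d1)
  (@ln_comp_deriv (fun y => I * y) _ _ It d2).
move=> d3; apply: (is_derive_eq d3).
by field; rewrite !gt_eqF//; lra.
Qed.

(** The factors show that [slope] increases up to 1/(2J), decreases from there to 1/Q, and increases
    again. As it vanishes at 1/Q, it is positive on both sides of that point; as it is negative near
    0, it has exactly one zero before. *)
Lemma slope_deriv t : 0 < t -> t < J^-1 ->
  is_derive t 1 slope ((1 - Q * t) * (1 - 2 * J * t) / (t * (1 - J * t)) ^+ 2).
Proof.
move=> t0 tJ; have Jt := JtI tJ; have h := log_ratio_deriv t0 tJ.
have p0 : t * (1 - J * t) != 0 by rewrite mulf_neq0 ?gt_eqF.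
have d1 : is_derive t 1 (fun t : R => t * (1 - J * t)) (1 - 2 * J * t).
  by apply: is_derive_eq; rewrite /GRing.scale /=; ring.
have d2 := @is_deriveV _ (fun t : R => t * (1 - J * t)) t _ 1 p0 d1.
have d3 := one_sub_deriv Q t.
have d4 := is_deriveM d3 d2.
have d5 := is_deriveB (is_deriveZ Q h) d4.
apply: (is_derive_eq d5); rewrite /GRing.scale /=.
by field; rewrite !gt_eqF.
Qed.

Lemma gval_deriv t : 0 < t -> t < J^-1 -> t != Q^-1 ->
  is_derive t 1 gval (I * slope t / (1 - Q * t) ^+ 2).
Proof.
have [I1 IJ IJQ J0 Q0] := IJQ5.
move=> t0 tJ tQ; have Jt := JtI tJ; have h := log_ratio_deriv t0 tJ.
have p0 : 1 - Q * t != 0.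
  apply: contra_neq tQ => e; apply: (mulfI (lt0r_neq0 Q0)).
  by rewrite divff ?gt_eqF//; lra.
have d3 := one_sub_deriv Q t.
have d4 := is_deriveM (is_deriveZ I (@is_deriveV _ (fun t : R => 1 - Q * t) t _ 1 p0 d3)) h.
apply: (is_derive_eq d4); rewrite /GRing.scale /= /GRing.scale /= /slope.
by field; rewrite p0 !gt_eqF.
Qed.

(** Equals [(1 - Q t) (gval t - b)] away from 1/Q. Clearing the denominator keeps it differentiable
    at 1/Q, where it vanishes for every [b]. *)
Definition gdiff b t := I * log_ratio t - b * (1 - Q * t).

Lemma gdiff_deriv b t : 0 < t -> t < J^-1 ->
  is_derive t 1 (gdiff b) (b * Q - I / (t * (1 - J * t))).
Proof.
move=> t0 tJ; have Jt := JtI tJ; have h := log_ratio_deriv t0 tJ.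
have d3 := one_sub_deriv Q t.
apply: (is_derive_eq (is_deriveB (is_deriveZ I h) (is_deriveZ b d3))).
by rewrite /GRing.scale /=; ring.
Qed.

Lemma log_ratio_Q : log_ratio Q^-1 = 0.
Proof.
have [I1 IJ IJQ J0 Q0] := IJQ5.
rewrite /log_ratio (_ : 1 - J * Q^-1 = I * Q^-1) ?subrr//.
by rewrite -{1}(divff (lt0r_neq0 Q0)) -mulrBl -IJQ addrK.
Qed.

Lemma gdiff_Q b : gdiff b Q^-1 = 0.
Proof.
have [I1 IJ IJQ J0 Q0] := IJQ5.
by rewrite /gdiff log_ratio_Q divff ?gt_eqF// subrr !mulr0 subrr. Qed.

Lemma slope_Q : slope Q^-1 = 0.
Proof.
have [I1 IJ IJQ J0 Q0] := IJQ5.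
by rewrite /slope log_ratio_Q divff ?gt_eqF// subrr !mulr0 mul0r subrr. Qed.

Let slope_right t : Q^-1 < t -> t < J^-1 -> 0 < slope t.
Proof.
have [I1 IJ IJQ J0 Q0] := IJQ5.
move=> Qt tJ; rewrite -slope_Q.
have Qi : 0 < Q^-1 by rewrite invr_gt0.
apply: (lt_of_is_derive_gt0 Qt (df := fun t =>
  (1 - Q * t) * (1 - 2 * J * t) / (t * (1 - J * t)) ^+ 2)).
  by move=> x /andP[? ?]; apply: slope_deriv; lra.
move=> x /andP[Qx xt]; rewrite divr_gt0 ?exprn_even_gt0//=; last first.
  by rewrite mulf_neq0 ?gt_eqF//; [lra|apply: JtI; lra].
by rewrite nmulr_rgt0 ?QtN//; have := JtQ (ltW Qx); lra.
Qed.

Let slope_mid t : (2 * J)^-1 <= t -> t < Q^-1 -> 0 < slope t.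
Proof.
have [I1 IJ IJQ J0 Q0] := IJQ5.
have [QJ' half_lt'] := (QJ, half_lt).
move=> Jt tQ; rewrite -slope_Q.
have Ji : 0 < (2 * J)^-1 by rewrite invr_gt0; lra.
apply: (lt_of_is_derive_lt0 tQ (df := fun t =>
  (1 - Q * t) * (1 - 2 * J * t) / (t * (1 - J * t)) ^+ 2)).
  by move=> x /andP[? ?]; apply: slope_deriv; lra.
move=> x /andP[tx xQ]; rewrite ltr_pdivrMr ?mul0r ?exprn_even_gt0//=; last first.
  by rewrite mulf_neq0 ?gt_eqF//; [lra|apply: JtI; lra].
by rewrite pmulr_rlt0 ?QtP//; have := @Jt2 x; lra.
Qed.

Let slope_left t t' : 0 < t -> t < t' -> t' <= (2 * J)^-1 -> slope t < slope t'.
Proof.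
have [QJ' half_lt'] := (QJ, half_lt).
move=> t0 tt' tJ.
apply: (lt_of_is_derive_gt0 tt' (df := fun t =>
  (1 - Q * t) * (1 - 2 * J * t) / (t * (1 - J * t)) ^+ 2)).
  by move=> x /andP[? ?]; apply: slope_deriv; lra.
move=> x /andP[tx xQ]; rewrite divr_gt0 ?exprn_even_gt0//=; last first.
  by rewrite mulf_neq0 ?gt_eqF//; [lra|apply: JtI; lra].
by rewrite pmulr_rgt0 ?QtP//; have := @Jt2' x; lra.
Qed.

Let slope_neg : exists2 t, 0 < t < (2 * J)^-1 & slope t < 0.
Proof.
have [I1 IJ IJQ J0 Q0] := IJQ5.
(* Here the square root of 1/t is 4Q, so [log_ratio t < 8 Q] by [ln_lt_sqrt], and
   [Q * log_ratio t * t] is at most 8 Q^2 t = 1/2, less than 1 - Q t. *)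
have [t tE] : exists t, t = (4 * Q)^-1 ^+ 2 by eexists.
have Q1 : 2 < Q by lra.
have t0 : 0 < t by rewrite tE exprn_gt0// invr_gt0; lra.
have Qt : Q * t = 16^-1 / Q by rewrite tE; field; rewrite gt_eqF.
have Qi : Q^-1 < 2^-1 by rewrite ltf_pV2 ?posrE//; lra.
have Qi0 : 0 < Q^-1 by rewrite invr_gt0.
have tJ : t < (2 * J)^-1.
  apply: (@lt_trans _ _ (2 * Q)^-1); last by rewrite ltf_pV2 ?posrE; lra.
  by rewrite -(ltr_pM2l Q0) Qt invfM mulrCA divff ?gt_eqF//; lra.
exists t; first by rewrite t0.
have Jt : 1 - J * t <= 1 by rewrite gerBl mulr_ge0// ltW.
have Jt0 : 2^-1 < 1 - J * t by have := Jt2' tJ; lra.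
have x0 : 0 < t^-1 by rewrite invr_gt0.
have Nt : log_ratio t < 2 * (4 * Q).
  have St : Num.sqrt t^-1 = 4 * Q.
    by rewrite tE -exprVn invrK sqrtr_sqr ger0_norm//; lra.
  have := ln_lt_sqrt x0; rewrite St lnV ?posrE// => h.
  rewrite /log_ratio lnM ?posrE//; last lra.
  by have := ln_le0 Jt; have := ln_ge0 I1; lra.
rewrite /slope subr_lt0 ltr_pdivlMr ?mulr_gt0//; last lra.
have a : Q * log_ratio t * (t * (1 - J * t)) <= Q * (2 * (4 * Q)) * (t * 1).
  have [N0|N0] := leP (log_ratio t) 0.
    apply: (@le_trans _ _ 0); last by rewrite !mulr_ge0//; lra.
    by rewrite mulr_le0_ge0// ?mulr_ge0_le0// ?mulr_ge0//; lra.
  by apply: ler_pM; rewrite ?mulr_ge0// ?ler_pM2l//; lra.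
apply: le_lt_trans a _.
rewrite (_ : Q * (2 * (4 * Q)) * (t * 1) = 2^-1); first by rewrite Qt; lra.
by rewrite tE; field; rewrite gt_eqF.
Qed.

Lemma log_ratio_gt0 t : 0 < t -> t < Q^-1 -> 0 < log_ratio t.
Proof.
have [I1 IJ IJQ J0 Q0] := IJQ5.
have [QJ' half_lt'] := (QJ, half_lt).
move=> t0 tQ; have QJ0 := QtP tQ.
have It : 0 < I * t by rewrite mulr_gt0//; lra.
rewrite /log_ratio subr_gt0 ltr_ln ?posrE//; last by apply: JtI; lra.
by move: QJ0; rewrite -IJQ mulrDl; lra.
Qed.

Lemma gval_lt_left b t : t < Q^-1 -> (gval t < b) = (gdiff b t < 0).
Proof.
move=> tQ; have h := QtP tQ.
by rewrite /gval /gdiff mulrAC ltr_pdivrMr// subr_lt0.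
Qed.

Lemma gval_gt_left b t : t < Q^-1 -> (b < gval t) = (0 < gdiff b t).
Proof.
move=> tQ; have h := QtP tQ.
by rewrite /gval /gdiff mulrAC ltr_pdivlMr// subr_gt0.
Qed.

Lemma gval_lt_right b t : Q^-1 < t -> (gval t < b) = (0 < gdiff b t).
Proof.
move=> tQ; have h := QtN tQ.
by rewrite /gval /gdiff mulrAC ltr_ndivrMr// subr_gt0.
Qed.

Lemma gval_gt_right b t : Q^-1 < t -> (b < gval t) = (gdiff b t < 0).
Proof.
move=> tQ; have h := QtN tQ.
by rewrite /gval /gdiff mulrAC ltr_ndivlMr// subr_lt0.
Qed.

Let slope_zero : exists2 tau, 0 < tau < (2 * J)^-1 &
  (forall t, 0 < t -> t < tau -> slope t < 0) /\
  (forall t, tau < t -> t < Q^-1 -> 0 < slope t).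
Proof.
have [I1 IJ IJQ J0 Q0] := IJQ5.
have [t0 /andP[t00 t0J] Mt0] := slope_neg.
have MJ : 0 < slope (2 * J)^-1 by exact: slope_mid.
have cM : {within `[t0, (2 * J)^-1], continuous slope}.
  apply/continuous_in_subspaceT => x; rewrite inE /= in_itv /= => /andP[? ?].
  by apply: is_derive_continuous (slope_deriv _ _); lra.
have [||tau] := IVT _ cM (v := 0); first exact: ltW.
  by rewrite ge_min le_max (ltW Mt0) (ltW MJ) orbT.
rewrite in_itv /= => /andP[t0tau tauJ] Mtau.
have tau0 : 0 < tau by exact: lt_le_trans t0tau.
have tauJ' : tau < (2 * J)^-1.
  by rewrite lt_neqAle tauJ andbT; apply: contraTneq MJ => <-; rewrite Mtau ltxx.
exists tau; first by rewrite tau0.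
split=> t ht ht'; first by rewrite -Mtau; apply: slope_left.
have [tJ|tJ] := leP t (2 * J)^-1; first by rewrite -Mtau slope_left.
by apply: slope_mid => //; exact: ltW.
Qed.

(** [gdiff Q] increases to its zero at 1/Q, since Q^2 t (1 - J t) - I = (1 - Q t)(Q J t - I), where
    both factors are positive on this range. *)
Let gval_left_Q t : (2 * J)^-1 <= t -> t < Q^-1 -> gval t < Q.
Proof.
have [I1 IJ IJQ J0 Q0] := IJQ5.
have [QJ' half_lt'] := (QJ, half_lt).
move=> Jt tQ; rewrite gval_lt_left// -(gdiff_Q Q).
have Ji : 0 < (2 * J)^-1 by rewrite invr_gt0; lra.
apply: (lt_of_is_derive_gt0 tQ (df := fun t => Q * Q - I / (t * (1 - J * t)))).
  by move=> x /andP[? ?]; apply: gdiff_deriv; lra.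
move=> x /andP[tx xQ]; have Jx : 0 < 1 - J * x by apply: JtI; lra.
rewrite subr_gt0 ltr_pdivrMr ?mulr_gt0//; last lra.
have Jx2 : 2^-1 < J * x by apply: Jt2; lra.
have QJx : Q * 2^-1 < Q * (J * x) by rewrite ltr_pM2l.
have : 0 < (1 - Q * x) * (Q * (J * x) - I) by rewrite mulr_gt0 ?QtP//; lra.
suff -> : (1 - Q * x) * (Q * (J * x) - I) = Q * Q * (x * (1 - J * x)) - I by lra.
by rewrite -IJQ; ring.
Qed.

(** The factorisation used on the left still applies; past 1/Q its first factor is negative. *)
Let gval_right_Q t : Q^-1 < t -> t < J^-1 -> Q < gval t.
Proof.
have [I1 IJ IJQ J0 Q0] := IJQ5.
move=> Qt tJ; rewrite gval_gt_right// -(gdiff_Q Q).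
have Qi : 0 < Q^-1 by rewrite invr_gt0.
apply: (lt_of_is_derive_lt0 Qt (df := fun t => Q * Q - I / (t * (1 - J * t)))).
  by move=> x /andP[? ?]; apply: gdiff_deriv; lra.
move=> x /andP[Qx xt]; have Jx : 0 < 1 - J * x by apply: JtI; lra.
rewrite subr_lt0 ltr_pdivlMr ?mulr_gt0//; last lra.
have Jx2 := JtQ (ltW Qx).
have QJx : Q * 2^-1 < Q * (J * x) by rewrite ltr_pM2l.
have : (1 - Q * x) * (Q * (J * x) - I) < 0 by rewrite nmulr_rlt0 ?QtN//; lra.
suff -> : (1 - Q * x) * (Q * (J * x) - I) = Q * Q * (x * (1 - J * x)) - I by lra.
by rewrite -IJQ; ring.
Qed.

(** The left limit of [gval] at 1/Q is Q, in the form that the intermediate value theorem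
    consumes. *)
Let gval_near_Q b tau : 0 < b -> b < Q -> tau < Q^-1 ->
  exists2 t, tau < t < Q^-1 & b < gval t.
Proof.
have [I1 IJ IJQ J0 Q0] := IJQ5.
have [QJ' half_lt'] := (QJ, half_lt).
move=> b0 bQ tauQ.
have [m mE] : exists m, m = Num.max tau (2 * J)^-1 by eexists.
have mQ : m < Q^-1 by rewrite mE gt_max tauQ half_lt.
(* [d] solves b Q (I/Q^2 + d) = I. Within distance [d] to the left of 1/Q one has t (1 - J t) <
   I/Q^2 + d, so the derivative of [gdiff b] is negative there. *)
have [d dE] : exists d, d = I * (Q - b) / (Q ^+ 2 * b) by eexists.
have d0 : 0 < d.
  by rewrite dE divr_gt0// mulr_gt0 ?exprn_gt0 ?subr_gt0//; lra.
pose c := Num.max m (Q^-1 - d).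
have cQ : c < Q^-1 by rewrite gt_max mQ; lra.
have [t tE] : exists t, t = (c + Q^-1) / 2 by eexists.
have [ct tQ] : c < t /\ t < Q^-1 by rewrite tE; split; lra.
have mt : m < t by apply: le_lt_trans ct; rewrite le_max lexx.
have dt : Q^-1 - d < t by apply: le_lt_trans ct; rewrite le_max lexx orbT.
have Jt : (2 * J)^-1 < t by apply: le_lt_trans mt; rewrite mE le_max lexx orbT.
have Ji : 0 < (2 * J)^-1 by rewrite invr_gt0; lra.
exists t; first by rewrite tQ andbT; apply: le_lt_trans mt; rewrite mE le_max lexx.
rewrite gval_gt_left// -(gdiff_Q b).
apply: (lt_of_is_derive_lt0 tQ (df := fun t => b * Q - I / (t * (1 - J * t)))).
  by move=> x /andP[? ?]; apply: gdiff_deriv; lra.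
move=> x /andP[tx xQ]; have Jx : 0 < 1 - J * x by apply: JtI; lra.
have x0 : 0 < x by lra.
rewrite subr_lt0 ltr_pdivlMr ?mulr_gt0//.
have E : x * (1 - J * x) = I / Q ^+ 2 + (Q^-1 - x) * (J * x - I / Q).
  rewrite -IJQ; field; rewrite gt_eqF//; lra.
have a : (Q^-1 - x) * (J * x - I / Q) <= (Q^-1 - x) * 1.
  rewrite ler_pM2l; last lra.
  by have : 0 <= I / Q by [rewrite divr_ge0; lra]; lra.
have a2 : x * (1 - J * x) < I / Q ^+ 2 + d by rewrite E; lra.
have -> : I = b * Q * (I / Q ^+ 2 + d).
  by rewrite dE; field; rewrite !gt_eqF.
by rewrite ltr_pM2l// mulr_gt0.
Qed.

Let gval_near_0 b tau : 0 < tau -> tau < (2 * J)^-1 ->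
  exists2 t, 0 < t < tau & b < gval t.
Proof.
have [I1 IJ IJQ J0 Q0] := IJQ5.
have [QJ' half_lt'] := (QJ, half_lt).
move=> tau0 tauJ.
(* For [t <= c], [I * t] is at most exp(-(|b| + 1))/2, while 1 - J t exceeds 1/2; the halves cancel
   and [log_ratio t >= |b| + 1]. *)
have [c cE] : exists c, c = expR (- (`|b| + 1)) / (2 * I) by eexists.
have c0 : 0 < c by rewrite cE divr_gt0 ?expR_gt0//; lra.
have [t tE] : exists t, t = Num.min (tau / 2) c by eexists.
have t0 : 0 < t by rewrite tE lt_min c0 divr_gt0.
have ttau : t < tau by rewrite tE gt_min; apply/orP; left; lra.
have tc : t <= c by rewrite tE ge_min lexx orbT.
exists t; first by rewrite t0.
have tJ : t < (2 * J)^-1 by lra.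
have Jt := Jt2' tJ.
have QtJ : t < Q^-1 by lra.
have Qt := QtP QtJ.
have It : 0 < I * t by rewrite mulr_gt0//; lra.
have N1 : `|b| + 1 <= log_ratio t.
  have : ln (I * t) <= ln (expR (- (`|b| + 1)) / 2).
    rewrite ler_ln ?posrE ?divr_gt0 ?expR_gt0//.
    have : I * t <= I * c by rewrite ler_pM2l//; lra.
    suff -> : I * c = expR (- (`|b| + 1)) / 2 by [].
    by rewrite cE; field; rewrite gt_eqF//; lra.
  rewrite ln_div ?posrE ?expR_gt0// expRK => h1.
  have : ln (2^-1) <= ln (1 - J * t) by rewrite ler_ln ?posrE; lra.
  by rewrite lnV ?posrE// /log_ratio; lra.
have bb := ler_norm b.
rewrite gval_gt_left// /gdiff subr_gt0.
have Nn : 0 <= `|b| by [].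
have : b * (1 - Q * t) <= `|b| * 1.
  apply: (@le_trans _ _ (`|b| * (1 - Q * t))); first by rewrite ler_pM2r.
  by rewrite ler_wpM2l// gerBl mulr_ge0; lra.
have : 1 * log_ratio t <= I * log_ratio t by rewrite ler_pM2r//; lra.
lra.
Qed.

(** [tau], the zero of [slope], is the minimum point. Past 1/Q the values exceed Q, so for b < Q all
    solutions lie on the two monotone branches that meet at [tau]. *)
Lemma gval_shape : exists2 tau, 0 < tau < Q^-1 &
  [/\ forall t t', 0 < t -> t < t' -> t' <= tau -> gval t' < gval t,
      forall t t', tau <= t -> t < t' -> t' < Q^-1 -> gval t < gval t',
      forall t t', Q^-1 < t -> t < t' -> t' < J^-1 -> gval t < gval t',
      forall t, Q^-1 < t -> t < J^-1 -> Q < gval t &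
      [/\ forall t, tau <= t -> t < Q^-1 -> gval t < Q,
          forall b, exists2 t, 0 < t < tau & b < gval t,
          forall b, 0 < b -> b < Q ->
            exists2 t, tau < t < Q^-1 & b < gval t &
          0 < gval tau]].
Proof.
have [I1 IJ IJQ J0 Q0] := IJQ5.
have [QJ' half_lt'] := (QJ, half_lt).
have [tau /andP[tau0 tauJ] [Mn Mp]] := slope_zero.
have tauQ : tau < Q^-1 by lra.
have Qi : 0 < Q^-1 by rewrite invr_gt0.
have sq t : t != Q^-1 -> 0 < (1 - Q * t) ^+ 2.
  move=> tQ; rewrite exprn_even_gt0//=.
  by have [/QtP|/QtN|/eqP] := ltgtP t Q^-1; [lra|lra|rewrite (negPf tQ)].
have incr t t' : tau <= t -> t < t' -> t' < Q^-1 -> gval t < gval t'.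
  move=> taut tt' t'Q.
  apply: (lt_of_is_derive_gt0 tt' (df := fun t => I * slope t / (1 - Q * t) ^+ 2)).
    by move=> x /andP[? ?]; apply: gval_deriv; rewrite ?lt_eqF//; lra.
  move=> x /andP[? ?]; have sx : 0 < (1 - Q * x) ^+ 2 by rewrite sq// lt_eqF//; lra.
  by apply: divr_gt0 sx; apply: mulr_gt0; [lra|apply: Mp; lra].
exists tau; first by rewrite tau0.
split=> //; last split.
- move=> t t' t0 tt' t'tau.
  apply: (lt_of_is_derive_lt0 tt' (df := fun t => I * slope t / (1 - Q * t) ^+ 2)).
    by move=> x /andP[? ?]; apply: gval_deriv; rewrite ?lt_eqF//; lra.
  move=> x /andP[? ?]; rewrite ltr_pdivrMr ?sq ?lt_eqF//; last lra.
  by rewrite mul0r pmulr_rlt0 ?Mn//; lra.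
- move=> t t' Qt tt' t'J.
  apply: (lt_of_is_derive_gt0 tt' (df := fun t => I * slope t / (1 - Q * t) ^+ 2)).
    by move=> x /andP[? ?]; apply: gval_deriv; rewrite ?gt_eqF//; lra.
  move=> x /andP[? ?]; have sx : 0 < (1 - Q * x) ^+ 2 by rewrite sq// gt_eqF//; lra.
  by apply: divr_gt0 sx; apply: mulr_gt0; [lra|apply: slope_right; lra].
- move=> t taut tQ; have [Jt|Jt] := leP (2 * J)^-1 t; first exact: gval_left_Q.
  by apply: lt_trans (incr _ _ taut Jt half_lt) _; exact: gval_left_Q.
- by move=> b; exact: gval_near_0.
- by move=> b b0 bQ; exact: gval_near_Q.
- by rewrite /gval mulr_gt0 ?log_ratio_gt0// divr_gt0 ?QtP//; lra.
Qed.

End shape_of_g.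

(** * The solutions u_i and v_i *)

Lemma inf_minE (R : realType) (S : set R) (x : R) : S x -> lbound S x -> inf S = x.
Proof.
move=> Sx lb; apply/eqP; rewrite eq_le lb_le_inf ?andbT//; last by exists x.
by apply: ge_inf => //; exists x.
Qed.

Lemma sup_maxE (R : realType) (S : set R) (x : R) : S x -> ubound S x -> sup S = x.
Proof.
move=> Sx ub; apply/eqP; rewrite eq_le ge_sup ?andTb//; last by exists x.
by apply: ub_le_sup => //; exists x.
Qed.

Section profile.
Context {R : realType}.
Variables q i : nat.
Hypotheses (i0 : (0 < i)%N) (iq : (2 * i < q)%N).

Local Notation I := (i%:R : R).
Local Notation J := ((q - i)%N%:R : R).
Local Notation Q := (q%:R : R).

(** A positive multiple of the slope of F along the line of points with [i] equal coordinates and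
    the others equal to [t], see [Phi_deriv]. *)
Definition kdiff (b t : R) := kappa b t - kappa b ((1 - J * t) / I).

Let IJQ : [/\ 1 <= I, I < J & I + J = Q].
Proof.
split; first by rewrite ler1n.
  by rewrite ltr_nat; lia.
by rewrite -natrD subnKC//; lia.
Qed.

Let Qi : 0 < Q^-1 /\ Q^-1 < J^-1.
Proof.
case: IJQ; move: I J Q => x y z h1 h2 h3.
by rewrite invr_gt0 ltf_pV2 ?posrE; lra.
Qed.

Let gE t : 0 < t -> t < J^-1 -> t != Q^-1 -> g q i t = gval I J Q t.
Proof.
move=> t0 tJ tQ; rewrite /g (negPf tQ) /gval /log_ratio.
case: IJQ => h1 h2 h3.
have J0 : 0 < J by apply: lt_trans h2; apply: lt_le_trans h1.
have I0 : 0 < I by apply: lt_le_trans h1.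
have Jt : 0 < 1 - J * t by rewrite subr_gt0 mulrC -ltr_pdivlMr// div1r.
by rewrite ln_div// posrE mulr_gt0.
Qed.

Let gQ : g q i Q^-1 = Q. Proof. by rewrite /g eqxx. Qed.

Lemma kdiffE b t : 0 < t -> t < J^-1 -> kdiff b t = - gdiff I J Q b t / I.
Proof.
move=> t0 tJ; case: IJQ => h1 h2 h3.
have J0 : 0 < J by apply: lt_trans h2; apply: lt_le_trans h1.
have I0 : 0 < I by apply: lt_le_trans h1.
have Jt : 0 < 1 - J * t by rewrite subr_gt0 mulrC -ltr_pdivlMr// div1r.
rewrite /kdiff /kappa /gdiff /log_ratio ln_div ?posrE// lnM ?posrE// -h3.
by field; rewrite gt_eqF.
Qed.

Let kd_lt b t : 0 < t -> t < Q^-1 -> (0 < kdiff b t) = (gval I J Q t < b).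
Proof.
move=> t0 tQ; case: IJQ => h1 h2 h3; case: Qi => Q0 QJ.
have I0 : 0 < I by apply: lt_le_trans h1.
rewrite (gval_lt_left IJQ)// kdiffE//; last exact: lt_trans QJ.
by rewrite pmulr_lgt0 ?invr_gt0// oppr_gt0.
Qed.

Let kd_gt b t : 0 < t -> t < Q^-1 -> (kdiff b t < 0) = (b < gval I J Q t).
Proof.
move=> t0 tQ; case: IJQ => h1 h2 h3; case: Qi => Q0 QJ.
have I0 : 0 < I by apply: lt_le_trans h1.
rewrite (gval_gt_left IJQ)// kdiffE//; last exact: lt_trans QJ.
by rewrite pmulr_llt0 ?invr_gt0// oppr_lt0.
Qed.

Let kd_eq b t : 0 < t -> t < Q^-1 -> (kdiff b t == 0) = (gval I J Q t == b).
Proof.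
by move=> t0 tQ; rewrite !eq_le !leNgt kd_lt// kd_gt// andbC.
Qed.

Let kd_right b t : Q^-1 < t -> t < J^-1 -> gval I J Q t < b -> kdiff b t < 0.
Proof.
move=> Qt tJ; case: IJQ => h1 h2 h3; case: Qi => Q0 QJ.
have I0 : 0 < I by apply: lt_le_trans h1.
rewrite (gval_lt_right IJQ)// kdiffE//; last exact: lt_trans Qt.
by rewrite pmulr_llt0 ?invr_gt0// oppr_lt0.
Qed.

Let gval_ivt (t t' c : R) : 0 < t -> t <= t' -> t' < Q^-1 ->
  Num.min (gval I J Q t) (gval I J Q t') <= c <=
  Num.max (gval I J Q t) (gval I J Q t') ->
  exists2 x, t <= x <= t' & gval I J Q x = c.
Proof.
move=> t0 tt' t'Q h; case: Qi => Q0 QJ.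
have cG : {within `[t, t'], continuous (gval I J Q)}.
  apply/continuous_in_subspaceT => x; rewrite inE /= in_itv /= => /andP[tx xt'].
  apply: is_derive_continuous (gval_deriv IJQ _ _ _).
  - exact: lt_le_trans tx.
  - by apply: le_lt_trans xt' _; exact: lt_trans QJ.
  - by rewrite lt_eqF//; exact: le_lt_trans t'Q.
have [x] := IVT tt' cG h.
by rewrite in_itv /= => xI xE; exists x.
Qed.

(** Translates the shape of g_i into signs of [kdiff], the only form used afterwards: on (0, 1/q)
    the sign is that of b - g_i(t). For [q < b] the two alternatives tell whether g_i takes the
    value [b] past 1/q; in either one F is at most F(p) at v_1. *)
Lemma profile : exists2 tau, 0 < tau < Q^-1 &
  [/\ 0 < beta_s R q i, beta_s R q i < Q,
  forall t, 0 < t -> t < Q^-1 -> kdiff (beta_s R q i) t <= 0 &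
  forall b,
  [/\ b < beta_s R q i -> forall t, 0 < t -> t < Q^-1 -> kdiff b t < 0,
      beta_s R q i <= b ->
        [/\ 0 < u q i b <= tau, kdiff b (u q i b) = 0 &
            forall t, 0 < t -> t < u q i b -> kdiff b t < 0],
      beta_s R q i <= b -> b < Q ->
        [/\ tau <= v q i b < Q^-1, kdiff b (v q i b) = 0,
            forall t, u q i b < t -> t < v q i b -> 0 < kdiff b t &
            forall t, v q i b < t -> t < Q^-1 -> kdiff b t < 0],
      beta_s R q i < b -> b < Q -> u q i b < v q i b &
      Q <= b ->
        [/\ forall t, u q i b < t -> t < Q^-1 -> 0 < kdiff b t,
            b = Q -> v q i b = Q^-1 &
            Q < b -> v q i b = u q i b \/ Q^-1 < v q i b < J^-1 /\
              forall t, Q^-1 < t -> t < v q i b -> kdiff b t < 0]]].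
Proof.
have [tau /andP[tau0 tauQ] [dec inc incr gtQ [ltQ near0 nearQ gtau0]]] :=
  gval_shape IJQ.
have [Q0 QJ] := Qi.
have gE' t : 0 < t -> t < Q^-1 -> g q i t = gval I J Q t.
  by move=> t0 tQ; apply: gE => //; [exact: lt_trans QJ|rewrite lt_eqF].
have gE2 t : Q^-1 < t -> t < J^-1 -> g q i t = gval I J Q t.
  by move=> t0 tQ; apply: gE => //; [exact: lt_trans t0|rewrite gt_eqF].
have gt_tau t : 0 < t -> t < Q^-1 -> gval I J Q tau <= gval I J Q t.
  move=> t0 tQ; have [ttau|taut|->//] := ltgtP t tau.
    by apply: ltW; exact: dec.
  by apply: ltW; apply: inc.
have bsE : beta_s R q i = gval I J Q tau.
  apply: inf_minE => /=.
    by exists tau; [rewrite /gdom /= tau0; exact: lt_trans QJ|exact: gE'].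
  move=> _ [t /= /andP[t0 tJ] <-]; have [tQ|Qt|->] := ltgtP t Q^-1.
  - by rewrite gE'// gt_tau.
  - by rewrite gE2//; apply: ltW; apply: lt_trans (gtQ _ Qt tJ); exact: ltQ.
  - by rewrite gQ; apply: ltW; exact: ltQ.
exists tau; first by rewrite tau0.
rewrite bsE; split=> //; first exact: ltQ.
  by move=> t t0 tQ; rewrite leNgt kd_lt// -leNgt gt_tau.
move=> b.
(* The solution on the decreasing branch (0, tau] is the smallest one, hence [u]. *)
have lowsol : gval I J Q tau <= b ->
    [/\ 0 < u q i b <= tau, gval I J Q (u q i b) = b &
        gsol q i b (u q i b)].
  move=> tb; have [t0 /andP[t00 t0tau] t0b] := near0 b.
  have [||x /andP[t0x xtau] xb] := @gval_ivt t0 tau b t00 _ tauQ.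
  - exact: ltW.
  - by rewrite ge_min le_max tb (ltW t0b) orbT.
  have x0 : 0 < x by exact: lt_le_trans t0x.
  have xQ : x < Q^-1 by exact: le_lt_trans tauQ.
  have Sx : gsol q i b x.
    split; last by rewrite gE'.
    by rewrite /gdom /= x0; exact: lt_trans QJ.
  suff -> : u q i b = x by rewrite x0 xtau.
  apply: inf_minE => // t [/= /andP[t0' tJ] tb']; rewrite leNgt; apply/negP => tx.
  have := dec _ _ t0' tx xtau; rewrite xb -gE'; last 2 first.
  - by [].
  - exact: lt_trans xQ.
  by rewrite tb' ltxx.
split.
- move=> bt t t0 tQ; rewrite kd_gt//; exact: lt_le_trans (gt_tau _ t0 tQ).
- move=> tb; have [/andP[u0 utau] ub _] := lowsol tb.
  have uQ : u q i b < Q^-1 by exact: le_lt_trans tauQ.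
  split; rewrite ?u0//; first by apply/eqP; rewrite kd_eq// ub.
  move=> t t0 tu; rewrite kd_gt//; last exact: lt_trans uQ.
  by rewrite -{1}ub; exact: dec.
- move=> tb bQ; have [/andP[u0 utau] ub _] := lowsol tb.
  have uQ : u q i b < Q^-1 by exact: le_lt_trans tauQ.
  have b0 : 0 < b by exact: lt_le_trans tb.
  (* The increasing branch takes the value [b] between [tau] and [t1]. Values past 1/q exceed q, so
     this solution is the largest one, hence [v]. *)
  have [t1 /andP[taut1 t1Q] t1b] := nearQ b b0 bQ.
  have [||x /andP[taux xt1] xb] := @gval_ivt tau t1 b tau0 _ t1Q.
  - exact: ltW.
  - by rewrite ge_min le_max tb (ltW t1b) orbT.
  have x0 : 0 < x by exact: lt_le_trans taux.
  have xQ : x < Q^-1 by exact: le_lt_trans t1Q.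
  have Sx : gsol q i b x.
    split; last by rewrite gE'.
    by rewrite /gdom /= x0; exact: lt_trans QJ.
  have -> : v q i b = x.
    apply: sup_maxE => // t [/= /andP[t0' tJ] tb']; rewrite leNgt; apply/negP => xt.
    have [tQ|Qt|tQ] := ltgtP t Q^-1.
    + by have := inc _ _ taux xt tQ; rewrite xb -gE'// tb' ltxx.
    + by have := gtQ _ Qt tJ; rewrite -gE2// tb' => /(lt_trans bQ); rewrite ltxx.
    + by move: tb'; rewrite tQ gQ => e; rewrite e ltxx in bQ.
  split; rewrite ?taux//; first by apply/eqP; rewrite kd_eq// xb.
  + move=> t ut tx; rewrite kd_lt//; last 2 first.
    * exact: lt_trans ut.
    * exact: lt_trans xQ.
    have [ttau|taut] := leP t tau; first by rewrite -[ltRHS]ub; exact: dec.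
    by rewrite -[ltRHS]xb; apply: inc => //; exact: ltW.
  + move=> t xt tQ; rewrite kd_gt//; last exact: lt_trans xt.
    by rewrite -{1}xb; exact: inc.
- move=> tb bQ; have tb' := ltW tb.
  have [/andP[u0 utau] ub _] := lowsol tb'.
  have ut : u q i b < tau.
    by rewrite lt_neqAle utau andbT; apply: contraTneq tb => e; rewrite -ub e ltxx.
  have b0 : 0 < b by exact: lt_trans tb.
  have [t1 /andP[taut1 t1Q] t1b] := nearQ b b0 bQ.
  have [||x /andP[taux xt1] xb] := @gval_ivt tau t1 b tau0 _ t1Q.
  - exact: ltW.
  - by rewrite ge_min le_max tb' (ltW t1b) orbT.
  apply: (lt_le_trans ut); apply: (le_trans taux); apply: ub_le_sup.
    by exists J^-1 => t [/= /andP[_ /ltW]].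
  have x0 : 0 < x by exact: lt_le_trans taux.
  have xQ : x < Q^-1 by exact: le_lt_trans t1Q.
  split; last by rewrite gE'.
  by rewrite /gdom /= x0; exact: lt_trans QJ.
- move=> Qb; have tb : gval I J Q tau <= b.
    by apply: ltW; apply: lt_le_trans Qb; exact: ltQ.
  have [/andP[u0 utau] ub Su] := lowsol tb.
  have ltb t : u q i b < t -> t < Q^-1 -> gval I J Q t < b.
    move=> ut tQ; have [ttau|/ltW taut] := leP t tau.
      by rewrite -[ltRHS]ub; exact: dec.
    by apply: lt_le_trans Qb; exact: ltQ.
  have uQ : u q i b < Q^-1 by exact: le_lt_trans tauQ.
  split.
  + by move=> t ut tQ; rewrite kd_lt ?ltb//; exact: lt_trans ut.
  + move=> bE; apply: sup_maxE.
      by split; [rewrite /gdom /= Q0|rewrite gQ].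
    move=> t [/= /andP[t0' tJ] tb']; rewrite leNgt; apply/negP => Qt.
    by have := gtQ _ Qt tJ; rewrite -gE2// tb' bE ltxx.
  (* Past 1/q the function is strictly increasing, so a solution [w] found there is the largest. *)
  + move=> Qb'; have [[w [[/andP[w0 wJ] wb] Qw]]|nw] :=
      pselect (exists w, gsol q i b w /\ Q^-1 < w).
      have wb' : gval I J Q w = b by rewrite -gE2.
      right; have -> : v q i b = w.
        apply: sup_maxE; first by split => //; rewrite /gdom /= w0.
        move=> t [/= /andP[t0' tJ] tb']; rewrite leNgt; apply/negP => wt.
        have := incr _ _ Qw wt tJ; rewrite -(gE2 t)//; last exact: lt_trans wt.
        by rewrite tb' wb' ltxx.
      split; first by rewrite Qw.
      move=> t Qt tw; apply: kd_right => //; first exact: lt_trans wJ.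
      by rewrite -[ltRHS]wb'; exact: incr.
    left; apply: sup_maxE => // t St; rewrite leNgt; apply/negP => ut.
    have [tQ|Qt|tQ] := ltgtP t Q^-1.
    * have := ltb _ ut tQ; rewrite -gE'//; last exact: lt_trans ut.
      by case: St => _ ->; rewrite ltxx.
    * by apply: nw; exists t.
    * by case: St => _; rewrite tQ gQ => e; rewrite e ltxx in Qb'.
Qed.

End profile.

(** * Energy on the lines of critical points *)

Section special_points.
Context {R : realType}.
Variable q : nat.
Hypothesis q5 : (5 <= q)%N.
Implicit Types (x y : 'rV[R]_q.-1) (b t : R) (k l m : 'I_q).

Let q0 : (0 < q)%N. Proof. by case: q q5. Qed.

Lemma natr_sub (i : nat) : (i <= q)%N -> i%:R + (q - i)%N%:R = q%:R :> R.
Proof. by move=> iq; rewrite -natrD subnKC. Qed.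

Lemma sum_pt1 (A B : R) k :
  \sum_m (if m == k then A else B) = A + (q - 1)%N%:R * B.
Proof.
rewrite (bigD1 k)//= eqxx; congr (_ + _).
rewrite (eq_bigr (fun=> B)) => [|m /negPf ->//].
by rewrite sumr_const cardC1 card_ord subn1 mulr_natl.
Qed.

Lemma sum_pt2 (A B : R) k l : k != l ->
  \sum_m (if (m == k) || (m == l) then A else B) =
  2 * A + (q - 2)%N%:R * B.
Proof.
move=> kl; rewrite (sum_split2 _ kl) !eqxx orbT.
(* Splitting a sum of ones counts the remaining indices: q - 2. *)
have := sum_split2 (fun=> 1 : R) kl; rewrite sumr_const card_ord => h.
rewrite (eq_bigr (fun=> B * 1)) => [|m /andP[/negPf -> /negPf ->]]; last first.
  by rewrite mulr1.
rewrite /= -mulr_sumr natrB ?h; last by lia.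
ring.
Qed.

Lemma coord_pt1 t k m :
  coord (pt1 q t k) m = if m == k then 1 - (q - 1)%N%:R * t else t.
Proof.
rewrite /pt1 coord_point_of//.
by rewrite [LHS](sum_pt1 _ _ k) subrK.
Qed.

Lemma coord_pt2 t k l m : k != l ->
  coord (pt2 q t k l) m =
  if (m == k) || (m == l) then (1 - (q - 2)%N%:R * t) / 2 else t.
Proof.
move=> kl; rewrite /pt2 coord_point_of//.
by rewrite [LHS](sum_pt2 _ _ kl) mulrC divfK ?subrK// pnatr_eq0.
Qed.

Lemma coord_pp m : coord (pp R q) m = q%:R^-1.
Proof.
rewrite /pp coord_point_of//.
by rewrite sumr_const card_ord -[LHS]mulr_natl divff// pnatr_eq0 -lt0n.
Qed.

Lemma pt1_pp k : pt1 q q%:R^-1 k = pp R q.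
Proof.
apply: coord_inj => m; rewrite coord_pt1 coord_pp; case: ifP => // _.
have qn : (q%:R : R) != 0 by rewrite pnatr_eq0 -lt0n.
by rewrite -{1}(divff qn) -(natr_sub (i := 1))// -mulrBl addrK mul1r natr_sub.
Qed.

Lemma pt2_pp k l : k != l -> pt2 q q%:R^-1 k l = pp R q.
Proof.
move=> kl; apply: coord_inj => m; rewrite coord_pt2// coord_pp.
case: ifP => // _.
have qn : (q%:R : R) != 0 by rewrite pnatr_eq0 -lt0n.
rewrite -{1}(divff qn) -{1}(natr_sub (i := 2)); last by lia.
by rewrite -mulrBl addrK mulrAC divff ?mul1r ?pnatr_eq0.
Qed.

(** F at a point with [i] equal coordinates and the others equal to [t], reduced to a function of
    one variable. *)
Definition Phi (i : nat) b t :=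
  i%:R * phi b ((1 - (q - i)%N%:R * t) / i%:R) + (q - i)%N%:R * phi b t.

Lemma F_pt1 b t k : F b (pt1 q t k) = Phi 1 b t.
Proof.
rewrite F_sum /Phi mul1r divr1 -(sum_pt1 _ _ k); apply: eq_bigr => m _.
by rewrite coord_pt1; case: ifP.
Qed.

Lemma F_pt2 b t k l : k != l -> F b (pt2 q t k l) = Phi 2 b t.
Proof.
move=> kl; rewrite F_sum /Phi -(sum_pt2 _ _ kl); apply: eq_bigr => m _.
by rewrite coord_pt2//; case: ifP.
Qed.

Lemma F_pp1 b : F b (pp R q) = Phi 1 b q%:R^-1.
Proof. by rewrite -(F_pt1 _ _ (Ordinal q0)) pt1_pp. Qed.

(** The lines of [pt1] and [pt2] meet at p, which is where [Phi 1] and [Phi 2] get compared. *)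
Lemma F_pp2 b : F b (pp R q) = Phi 2 b q%:R^-1.
Proof.
have q1 : (1 < q)%N by lia.
have kl : Ordinal q0 != Ordinal q1 by [].
by rewrite -(F_pt2 _ _ kl) pt2_pp.
Qed.

Lemma Xi_pp : Xi (pp R q).
Proof. by apply/(XiP q0) => m; rewrite coord_pp. Qed.

Lemma Xi_pt1 t k : 0 <= t -> t <= (q - 1)%N%:R^-1 -> Xi (pt1 q t k).
Proof.
move=> t0 tq; apply/(XiP q0) => m; rewrite coord_pt1; case: ifP => // _.
have h : 0 < (q - 1)%N%:R :> R by rewrite ltr0n subn_gt0; lia.
by rewrite subr_ge0 mulrC -ler_pdivlMr// div1r.
Qed.

Lemma Xi_pt2 t k l : k != l -> 0 <= t -> t <= (q - 2)%N%:R^-1 ->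
  Xi (pt2 q t k l).
Proof.
move=> kl t0 tq; apply/(XiP q0) => m; rewrite coord_pt2//; case: ifP => // _.
have h : 0 < (q - 2)%N%:R :> R by rewrite ltr0n subn_gt0; lia.
by rewrite divr_ge0// subr_ge0 mulrC -ler_pdivlMr// div1r.
Qed.

(** * Monotonicity of the energy along a line *)

Section Phi_monotone.
Variable i : nat.
Hypotheses (i0 : (0 < i)%N) (iq : (2 * i < q)%N).

Lemma Phi_deriv b t : 0 < b -> 0 < t -> t < (q - i)%N%:R^-1 ->
  is_derive t 1 (Phi i b) ((q - i)%N%:R / b * kdiff q i b t).
Proof.
move=> b0 t0 tJ; rewrite /Phi /kdiff.
have I0 : 0 < i%:R :> R by rewrite ltr0n.
have J0 : 0 < (q - i)%N%:R :> R by rewrite ltr0n subn_gt0; lia.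
move: (i%:R : R) ((q - i)%N%:R : R) I0 J0 tJ => I J I0 J0 tJ.
have s0 : 0 < (1 - J * t) / I.
  by rewrite divr_gt0// subr_gt0 mulrC -ltr_pdivlMr// div1r.
have ds : is_derive t 1 (fun t : R => (1 - J * t) / I) (- J / I).
  by apply: is_derive_eq; rewrite /GRing.scale /=; ring.
have d1 := @is_derive1_comp R (phi b) (fun t => (1 - J * t) / I) t _ _
  (is_derive_phi b0 s0) ds.
have d2 := is_derive_phi b0 t0.
apply: (is_derive_eq (is_deriveD (is_deriveZ I d1) (is_deriveZ J d2))).
by rewrite /GRing.scale /=; field; rewrite !gt_eqF.
Qed.

Lemma Phi_mean_value b t t' : 0 < b -> 0 < t -> t < t' ->
  t' < (q - i)%N%:R^-1 -> exists2 c, t < c < t' &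
  Phi i b t' - Phi i b t = (q - i)%N%:R / b * kdiff q i b c * (t' - t).
Proof.
move=> b0 t0 tt' t'J.
have Phid z : t <= z <= t' ->
    is_derive z 1 (Phi i b) ((q - i)%N%:R / b * kdiff q i b z).
  move=> /andP[tz zt]; apply: Phi_deriv => //; first exact: lt_le_trans tz.
  exact: le_lt_trans t'J.
have Phid' z : t < z < t' ->
    is_derive z 1 (Phi i b) ((q - i)%N%:R / b * kdiff q i b z).
  by move=> /andP[tz zt]; apply: Phid; rewrite !ltW.
have Phic z : t <= z <= t' -> {for z, continuous (Phi i b)}.
  by move=> /Phid; exact: is_derive_continuous.
exact: (mean_value tt' Phid' Phic).
Qed.

Let Jb b : 0 < b -> 0 < (q - i)%N%:R / b.
Proof. by move=> b0; rewrite divr_gt0// ltr0n subn_gt0; lia. Qed.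

Lemma Phi_incr b t t' : 0 < b -> 0 < t -> t < t' -> t' < (q - i)%N%:R^-1 ->
  (forall z, t < z -> z < t' -> 0 < kdiff q i b z) -> Phi i b t < Phi i b t'.
Proof.
move=> b0 t0 tt' t'J h.
have [c /andP[tc ct] E] := Phi_mean_value b0 t0 tt' t'J.
rewrite -subr_gt0 E; apply: mulr_gt0; last by rewrite subr_gt0.
by apply: mulr_gt0; [exact: Jb|exact: h].
Qed.

Lemma Phi_decr b t t' : 0 < b -> 0 < t -> t < t' -> t' < (q - i)%N%:R^-1 ->
  (forall z, t < z -> z < t' -> kdiff q i b z < 0) -> Phi i b t' < Phi i b t.
Proof.
move=> b0 t0 tt' t'J h.
have [c /andP[tc ct] E] := Phi_mean_value b0 t0 tt' t'J.
by rewrite -subr_lt0 E -mulrA pmulr_rlt0 ?Jb// nmulr_rlt0 ?h// subr_gt0.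
Qed.

Lemma Phi_noninc b t t' : 0 < b -> 0 < t -> t <= t' -> t' < (q - i)%N%:R^-1 ->
  (forall z, t < z -> z < t' -> kdiff q i b z <= 0) -> Phi i b t' <= Phi i b t.
Proof.
move=> b0 t0; rewrite le_eqVlt => /predU1P[->//|tt'] t'J h.
have [c /andP[tc ct] E] := Phi_mean_value b0 t0 tt' t'J.
by rewrite -subr_le0 E -mulrA pmulr_rle0 ?Jb// mulr_le0_ge0 ?h// subr_ge0 ltW.
Qed.

End Phi_monotone.

(** By quasiconcavity and the equal values at [v0] and [s], kappa is below [kappa b v0] to the left
    of [v0] and above it between [v0] and [s]. So [phi b] lies strictly above its tangent at [v0] on
    all of [0, s], though it is not convex there. *)
Lemma phi_tangent b v0 s (y : R) : 0 < b -> 0 < v0 -> v0 < s ->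
  kappa b v0 = kappa b s -> 0 <= y -> y <= s -> y != v0 ->
  phi b v0 + b^-1 * (kappa b v0 + 1) * (y - v0) < phi b y.
Proof.
move=> b0 v00 v0s kE y0 ys yv; have bi : 0 < b^-1 by rewrite invr_gt0.
have [yv0|v0y|e] := ltgtP y v0; last by rewrite e eqxx in yv.
- have [c /andP[yc cv] E] := phi_mean_value b0 y0 yv0.
  have kc : kappa b c < kappa b v0.
    have c0 : 0 < c by exact: le_lt_trans yc.
    by case: (kappa_mid b0 c0 cv v0s) => //; rewrite -kE ltxx.
  have : b^-1 * (kappa b c + 1) * (v0 - y) < b^-1 * (kappa b v0 + 1) * (v0 - y).
    by rewrite ltr_pM2r ?subr_gt0// ltr_pM2l// ltrD2r.
  by rewrite -E; rewrite -(opprB v0 y) mulrN; lra.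
- have [c /andP[vc cy] E] := phi_mean_value b0 (ltW v00) v0y.
  have kc : kappa b v0 < kappa b c.
    have cs : c < s by exact: lt_le_trans ys.
    by case: (kappa_mid b0 v00 vc cs) => //; rewrite -kE.
  have : b^-1 * (kappa b v0 + 1) * (y - v0) < b^-1 * (kappa b c + 1) * (y - v0).
    by rewrite ltr_pM2r ?subr_gt0// ltr_pM2l// ltrD2r.
  by rewrite -E; lra.
Qed.

(** Add up the tangent inequalities over all coordinates but [k]. A coordinate where [x] differs
    from the point gives strictness. *)
Lemma F_pt1_min b t x k : 0 < b -> 0 < t -> t < 1 - (q - 1)%N%:R * t ->
  kappa b t = kappa b (1 - (q - 1)%N%:R * t) -> Xi x ->
  coord x k = 1 - (q - 1)%N%:R * t -> (forall m, coord x m <= coord x k) ->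
  x != pt1 q t k -> Phi 1 b t < F b x.
Proof.
move=> b0 t0 ts kE /(XiP q0) x0 xk xm xt.
have [m mP] : exists m, coord x m != coord (pt1 q t k) m.
  apply: contraNP xt => /forallNP h; apply/eqP; apply: coord_inj => m.
  by apply/eqP; have := h m; case: eqP.
have mk : m != k by apply: contraNneq mP => ->; rewrite coord_pt1 eqxx xk.
rewrite coord_pt1 (negPf mk) in mP.
pose c := b^-1 * (kappa b t + 1).
(* The linear terms cancel: the coordinates other than [k] have total (q - 1) t. *)
have E : Phi 1 b t = \sum_m (if m == k then phi b (coord x k)
    else phi b t + c * (coord x m - t)).
  rewrite (bigD1 k)//= eqxx.
  rewrite (eq_bigr (fun m => (phi b t - c * t) + c * coord x m)); last first.
    by move=> j /negPf ->; ring.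
  rewrite big_split /= -mulr_sumr sumr_const cardC1 card_ord -subn1.
  have -> : \sum_(j | j != k) coord x j = (q - 1)%N%:R * t.
    by have := coord_sum q0 x; rewrite (bigD1 k)//= xk; lra.
  by rewrite /Phi mul1r divr1 -[(phi b t - c * t) *+ _]mulr_natl xk; ring.
rewrite E F_sum (bigD1 k)//= [ltRHS](bigD1 k)//= eqxx ltrD2l.
rewrite (bigD1 m)//= [ltRHS](bigD1 m)//= (negPf mk).
apply: ltr_leD; first by apply: (phi_tangent b0 t0 ts) => //; rewrite -xk.
apply: ler_sum => j /andP[/negPf -> _].
have [->|jt] := eqVneq (coord x j) t; first by rewrite subrr mulr0 addr0.
by apply/ltW/(phi_tangent b0 t0 ts) => //; rewrite -xk.
Qed.

End special_points.

(** * Descent directions *)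

Section descent.
Context {R : realType}.
Variable q : nat.
Hypothesis q5 : (5 <= q)%N.
Implicit Types (x y : 'rV[R]_q.-1) (b t r s : R) (k l m a c : 'I_q).

Let q0 : (0 < q)%N. Proof. by case: q q5. Qed.

Definition move x (w : 'I_q -> R) r : 'rV[R]_q.-1 :=
  of_coords (fun m => coord x m + r * w m).

Lemma coord_move x w r m : \sum_m w m = 0 ->
  coord (move x w r) m = coord x m + r * w m.
Proof.
move=> w0; rewrite /move coord_of_coords//.
by rewrite big_split /= coord_sum// -mulr_sumr w0 mulr0 addr0.
Qed.

Definition pair_dir k l m : R := (m == k)%:R - (m == l)%:R.

(** The coordinates [k] and [l] move together, so their equality survives. *)
Definition triple_dir k l a m : R :=
  (m == k)%:R + (m == l)%:R - 2 * (m == a)%:R.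

Lemma sum_delta k : \sum_m (m == k)%:R = 1 :> R.
Proof. by rewrite (bigD1 k)//= eqxx big1 ?addr0// => m /negPf ->. Qed.

Lemma sum_pair_dir k l : \sum_m pair_dir k l m = 0.
Proof. by rewrite /pair_dir sumrB !sum_delta subrr. Qed.

Lemma sum_triple_dir k l a : \sum_m triple_dir k l a m = 0.
Proof.
rewrite /triple_dir sumrB big_split /= -mulr_sumr !sum_delta; ring.
Qed.

Lemma coord_pair x k l r m : k != l ->
  coord (move x (pair_dir k l) r) m =
  if m == k then coord x k + r else if m == l then coord x l - r else coord x m.
Proof.
move=> kl; rewrite coord_move ?sum_pair_dir// /pair_dir.
have [->|mk] := eqVneq m k; first by rewrite (negPf kl) /=; ring.
by have [->|ml] := eqVneq m l; rewrite /=; ring.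
Qed.

Lemma coord_triple x k l a r m : k != l -> a != k -> a != l ->
  coord (move x (triple_dir k l a) r) m =
  if m == k then coord x k + r else if m == l then coord x l + r
  else if m == a then coord x a - 2 * r else coord x m.
Proof.
move=> kl ak al; rewrite coord_move ?sum_triple_dir// /triple_dir.
have [->|mk] := eqVneq m k.
  by rewrite (negPf kl) eq_sym (negPf ak) /=; ring.
have [->|ml] := eqVneq m l; first by rewrite eq_sym (negPf al) /=; ring.
by have [->|ma] := eqVneq m a; rewrite /=; ring.
Qed.

Lemma Xi_pair x k l r : k != l -> Xi x -> 0 <= r -> r <= coord x l ->
  Xi (move x (pair_dir k l) r).
Proof.
move=> kl /(XiP q0) x0 r0 rl; apply/(XiP q0) => m; rewrite coord_pair//.
case: ifP => _; first by rewrite addr_ge0.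
by case: ifP => _; rewrite ?subr_ge0.
Qed.

Lemma F_pair_lt b x k l r : 0 < b -> k != l -> Xi x -> 0 < r -> r <= coord x l ->
  (forall z w, coord x k < z < coord x k + r ->
     coord x l - r < w < coord x l -> kappa b z < kappa b w) ->
  F b (move x (pair_dir k l) r) < F b x.
Proof.
move=> b0 kl /(XiP q0) x0 r0 rl h; rewrite -subr_lt0 (F_pair b kl); last first.
  by move=> m /negPf mk /negPf ml; rewrite coord_pair// mk ml.
rewrite !coord_pair// eqxx eq_sym (negPf kl) eqxx subr_lt0.
by have := @phi_exchange R b _ _ r r 1 1 b0 (x0 k) r0 r0 rl ltr01 erefl h; rewrite !mul1r.
Qed.

(* [coord x k = 0] is a separate case because [ln 0 = 0]: the derivative of the
   energy is -oo there, but [kappa b 0 = 0]. *)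
Lemma pair_descent b x k l : 0 < b -> k != l -> Xi x -> 0 < coord x l ->
  coord x k = 0 \/ kappa b (coord x k) < kappa b (coord x l) ->
  exists2 e, 0 < e &
    forall r, 0 < r -> r <= e -> Xi (move x (pair_dir k l) r) /\
      F b (move x (pair_dir k l) r) < F b x.
Proof.
move=> b0 kl Xx xl h; have /(XiP q0) x0 := Xx.
have [e e0 he] := kappa_gap b0 (x0 k) xl h.
exists (Num.min (e / 2) (coord x l)); first by rewrite lt_min xl divr_gt0.
move=> r r0; rewrite le_min => /andP[re rl]; split.
  by apply: Xi_pair => //; exact: ltW.
apply: F_pair_lt => // z w /andP[kz zk] /andP[lw wl]; apply: he.
- exact: le_lt_trans kz.
- by rewrite ltr_norml; lra.
- by rewrite ltr_norml; lra.
Qed.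

(** Past 1/b kappa decreases, so two equal coordinates there are unstable: mass moved from one to
    the other goes to lower potential. *)
Lemma pair_descent_above b x k l : 0 < b -> k != l -> Xi x ->
  b^-1 < coord x l -> coord x k = coord x l ->
  exists2 e, 0 < e &
    forall r, 0 < r -> r <= e -> Xi (move x (pair_dir k l) r) /\
      F b (move x (pair_dir k l) r) < F b x.
Proof.
move=> b0 kl Xx xl xkl; have /(XiP q0) x0 := Xx.
have bi : 0 < b^-1 by rewrite invr_gt0.
exists (coord x l - b^-1); first lra.
move=> r r0 re; split; first by apply: Xi_pair => //; lra.
apply: F_pair_lt => //; first lra.
by move=> z w /andP[kz zk] /andP[lw wl]; apply: kappa_decr => //; lra.
Qed.

Lemma segment_move x k l r rho : k != l ->
  x + rho *: (move x (pair_dir k l) r - x) = move x (pair_dir k l) (rho * r).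
Proof.
move=> kl; apply: coord_inj => m; rewrite coord_segment// !coord_move ?sum_pair_dir//.
ring.
Qed.

Lemma coord_eq_pt1 x k t : (forall m, m != k -> coord x m = t) -> x = pt1 q t k.
Proof.
move=> h; apply: coord_inj => m; rewrite coord_pt1//.
case: ifPn => [/eqP ->|/h//].
have := coord_sum q0 x; rewrite (bigD1 k)//= (eq_bigr (fun=> t))//.
by rewrite sumr_const cardC1 card_ord -subn1 mulr_natl => <-; rewrite addrK.
Qed.

(** Stability is phrased through segments on which F stays below its value at [x]: from a point of a
    sublevel component such segments do not leave the component, so a minimiser over the component
    is stable. *)
Lemma stable_point b x : 0 < b -> Xi x ->
  (forall y, Xi y ->
     (forall r, 0 < r <= 1 -> Xi (x + r *: (y - x)) /\ F b (x + r *: (y - x)) < F b x) ->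
     False) ->
  x = pp R q \/ exists k t, [/\ x = pt1 q t k, 0 < t < q%:R^-1 & kdiff q 1 b t = 0].
Proof.
move=> b0 Xx st; have /(XiP q0) x0 := Xx.
have nodesc k l : k != l -> ~ exists2 e, 0 < e &
    forall r, 0 < r -> r <= e -> Xi (move x (pair_dir k l) r) /\
      F b (move x (pair_dir k l) r) < F b x.
  move=> kl [e e0 he]; apply: (st (move x (pair_dir k l) e)).
    by case: (he e).
  move=> r /andP[r0 r1]; rewrite segment_move//; apply: he; first by rewrite mulr_gt0.
  by rewrite ger_pMl.
have [c xc] : exists c, 0 < coord x c.
  apply: contrapT => /forallNP h; have := coord_sum q0 x; rewrite big1.
    by move/eqP; rewrite eq_sym oner_eq0.
  by move=> m _; apply/eqP; rewrite eq_le x0 andbT leNgt; apply/negP.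
have pos a : 0 < coord x a.
  rewrite lt_def x0 andbT; apply/eqP => xa.
  have ac : a != c by apply: contraTneq xc => <-; rewrite xa ltxx.
  by apply: (nodesc _ _ ac); apply: pair_descent => //; left.
have keq a d : kappa b (coord x a) = kappa b (coord x d).
  have le k l : kappa b (coord x l) <= kappa b (coord x k).
    have [->//|kl] := eqVneq k l; rewrite leNgt; apply/negP => h.
    by apply: (nodesc _ _ kl); apply: pair_descent => //; right.
  by apply/eqP; rewrite eq_le !le.
have low a d : coord x a <= b^-1 -> coord x d <= b^-1 -> coord x a = coord x d.
  move=> xa xd; have [h|h|//] := ltgtP (coord x a) (coord x d).
    by have := kappa_incr b0 (pos a) h xd; rewrite (keq a d) ltxx.
  by have := kappa_incr b0 (pos d) h xa; rewrite (keq a d) ltxx.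
(* If no coordinate exceeds 1/b, injectivity of kappa up to 1/b makes all of them equal. *)
have [[k xk]|/forallNP all] := pselect (exists k, b^-1 < coord x k); last first.
  left; have ale m : coord x m <= b^-1 by rewrite leNgt; apply/negP/all.
  apply: coord_inj => m; rewrite coord_pp//.
  have := coord_sum q0 x; rewrite (eq_bigr (fun=> coord x m)); last by move=> *; exact: low.
  rewrite sumr_const card_ord => e.
  have qn : (q%:R : R) != 0 by rewrite pnatr_eq0 -lt0n.
  by apply: (mulfI qn); rewrite mulr_natl e divff.
(* Two coordinates above 1/b have equal potential, hence are equal, and such a pair is unstable. *)
have lo m : m != k -> coord x m <= b^-1.
  move=> mk; rewrite leNgt; apply/negP => xm.
  have e : coord x m = coord x k.
    have [h|h|//] := ltgtP (coord x m) (coord x k).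
      by have := kappa_decr b0 (ltW xm) h; rewrite (keq m k) ltxx.
    by have := kappa_decr b0 (ltW xk) h; rewrite (keq m k) ltxx.
  by apply: (nodesc _ _ mk); apply: pair_descent_above.
right; have [d dk] : exists d, d != k.
  have [e|e] := eqVneq k (Ordinal q0).
    have q1 : (1 < q)%N by lia.
    by exists (Ordinal q1); rewrite e.
  by exists (Ordinal q0); rewrite eq_sym.
exists k, (coord x d); have xE := @coord_eq_pt1 x k (coord x d).
have {}xE : x = pt1 q (coord x d) k by apply: xE => m mk; apply: low; apply: lo.
have skE : coord x k = 1 - (q - 1)%N%:R * coord x d by rewrite {1}xE coord_pt1// eqxx.
have dlt : coord x d < coord x k by apply: le_lt_trans (lo d dk) xk.
split=> //.
- rewrite pos /= -[ltRHS]div1r ltr_pdivlMr ?ltr0n//.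
  have <- : 1%:R + (q - 1)%N%:R = q%:R :> R by apply: natr_sub; lia.
  by rewrite mulrDr mulr1n mulr1 [X in _ + X]mulrC; lra.
- by rewrite /kdiff divr1 -skE (keq d k) subrr.
Qed.

Lemma finite_gap (P : pred 'I_q) (f : 'I_q -> R) s :
  (forall m, P m -> f m < s) ->
  exists2 e, 0 < e & forall m, P m -> f m + e <= s.
Proof.
move=> h; have : forall r : seq 'I_q, exists2 e, 0 < e &
    forall m, m \in r -> P m -> f m + e <= s.
  elim=> [|a r [e e0 he]]; first by exists 1.
  have [Pa|nPa] := boolP (P a); last first.
    exists e => // m; rewrite inE => /predU1P[->|/he//]; by rewrite (negPf nPa).
  exists (Num.min e (s - f a)); first by rewrite lt_min e0 subr_gt0 h.
  move=> m; rewrite inE => /predU1P[->|mr] Pm.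
    by rewrite -lerBrDl ge_min lexx orbT.
  by apply: le_trans (he m mr Pm); rewrite lerD2l ge_min lexx.
by case/(_ (enum 'I_q)) => e e0 he; exists e => // m; apply: he; rewrite mem_enum.
Qed.

(** The wall between the regions where [k] and where [l] carries the largest coordinate, cut off
    below height [s]. *)
Definition ridge k l s : set 'rV[R]_q.-1 :=
  [set x | [/\ Xi x, coord x k = coord x l, forall m, coord x m <= coord x k &
               s <= coord x k]].

Lemma closed_ridge k l s : closed (ridge k l s).
Proof.
move=> x cx; have cc := @continuous_coord R q.
have cs (c' : R) : {for x, continuous (fun _ : 'rV[R]_q.-1 => c' : R)}.
  by move=> B; exact: (@cst_continuous 'rV[R]_q.-1 R c' x B).
split.
- by apply: closed_Xi => //; apply: closureS cx => y [].
- apply/eqP; rewrite eq_le; apply/andP; split.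
    by apply: (closure_le (cc k x) (cc l x) _ cx) => y [_ -> _ _].
  by apply: (closure_le (cc l x) (cc k x) _ cx) => y [_ -> _ _].
- by move=> m; apply: (closure_le (cc m x) (cc k x) _ cx) => y [].
- by apply: (closure_le (cs s) (cc k x) _ cx) => y [].
Qed.

Lemma F_triple_up b x k l a r : 0 < b -> k != l -> a != k -> a != l -> Xi x ->
  coord x k = coord x l -> 0 < r -> 2 * r <= coord x a ->
  (forall z w, coord x k < z < coord x k + r ->
     coord x a - 2 * r < w < coord x a -> kappa b z < kappa b w) ->
  F b (move x (triple_dir k l a) r) < F b x.
Proof.
move=> b0 kl ak al /(XiP q0) x0 xkl r0 ra h.
rewrite -subr_lt0 (F_triple b kl ak al); last first.
  by move=> m /negPf mk /negPf ml /negPf ma; rewrite coord_triple// mk ml ma.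
rewrite !coord_triple// eqxx eq_sym (negPf kl) eqxx (negPf ak) (negPf al) eqxx.
rewrite -xkl.
have r20 : 0 < 2 * r by lra.
have m20 : 0 < 2 :> R by [].
have e : 2 * r = 1 * (2 * r) by rewrite mul1r.
by have := phi_exchange b0 (x0 k) r0 r20 ra m20 e h; rewrite !mul1r; lra.
Qed.

Lemma F_triple_down b x k l a r : 0 < b -> k != l -> a != k -> a != l -> Xi x ->
  coord x k = coord x l -> 0 < r -> r <= coord x k ->
  (forall z w, coord x a < z < coord x a + 2 * r ->
     coord x k - r < w < coord x k -> kappa b z < kappa b w) ->
  F b (move x (triple_dir k l a) (- r)) < F b x.
Proof.
move=> b0 kl ak al /(XiP q0) x0 xkl r0 ra h.
rewrite -subr_lt0 (F_triple b kl ak al); last first.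
  by move=> m /negPf mk /negPf ml /negPf ma; rewrite coord_triple// mk ml ma.
rewrite !coord_triple// eqxx eq_sym (negPf kl) eqxx (negPf ak) (negPf al) eqxx.
rewrite -xkl mulrN opprK.
have r20 : 0 < 2 * r by lra.
have e : 1 * (2 * r) = 2 * r by rewrite mul1r.
by have := phi_exchange b0 (x0 a) r20 r0 ra ltr01 e h; rewrite !mul1r; lra.
Qed.

Lemma coord_eq_pt2 x k l t : k != l -> coord x k = coord x l ->
  (forall m, m != k -> m != l -> coord x m = t) -> x = pt2 q t k l.
Proof.
move=> kl xkl h; have := coord_sum q0 x; have := coord_sum q0 (pt2 q t k l).
rewrite !(sum_split2 _ kl) -xkl !coord_pt2// !eqxx orbT.
rewrite (eq_bigr (coord x)) => [|m /andP[mk ml]]; last first.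
  by rewrite coord_pt2// (negPf mk) (negPf ml) h.
rewrite /= => e1 e2.
have e : coord x k = (1 - (q - 2)%N%:R * t) / 2 by lra.
apply: coord_inj => m; rewrite coord_pt2//.
have [->|mk] := eqVneq m k; first by [].
by have [->|ml] := eqVneq m l; rewrite -?xkl//= h.
Qed.

(* The moves (r, r, -2r) and (-r, -r, 2r) on the coordinates k, l, a show that all
   the other coordinates a have the chemical potential of k and l. *)
Lemma ridge_min b s x k l : 0 < b -> k != l -> b^-1 <= s -> q%:R^-1 <= s ->
  ridge k l s x -> (forall y, ridge k l s y -> F b x <= F b y) ->
  s < coord x k ->
  exists t, [/\ x = pt2 q t k l, 0 < t < q%:R^-1 & kdiff q 2 b t = 0].
Proof.
move=> b0 kl bs qs [Xx xkl xm sx] xmin sk; have /(XiP q0) x0 := Xx.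
have bi : 0 < b^-1 by rewrite invr_gt0.
set M := coord x k in xm sx sk *.
have up a r : a != k -> a != l -> 0 < r -> 2 * r <= coord x a ->
  exists2 z, M < z < M + r & exists2 w, coord x a - 2 * r < w < coord x a &
    kappa b w <= kappa b z.
  move=> ak al r0 ra; apply: contrapT => h.
  have {}h z w : M < z < M + r -> coord x a - 2 * r < w < coord x a ->
      kappa b z < kappa b w.
    move=> zI wI; rewrite ltNge; apply/negP => wz; apply: h.
    by exists z => //; exists w.
  have := F_triple_up b0 kl ak al Xx xkl r0 ra h; rewrite ltNge xmin//.
  split.
  - apply/(XiP q0) => m; rewrite coord_triple//; case: ifP => _.
      by rewrite addr_ge0// ltW.
    by case: ifP => _; [rewrite addr_ge0// ltW|case: ifP; rewrite ?subr_ge0].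
  - by rewrite !coord_triple// eqxx eq_sym (negPf kl) eqxx xkl.
  - move=> m; rewrite !coord_triple// eqxx; case: ifP => // _.
    case: ifP => _; first by rewrite -xkl.
    by have := xm m; have := xm a; case: ifP => _; rewrite -/M; lra.
  - by rewrite coord_triple// eqxx -/M; lra.
have lt a : a != k -> a != l -> coord x a < M.
  move=> ak al; rewrite lt_neqAle xm andbT; apply/eqP => xa.
  (* The range (M - 2r, M) is then (s, M), above 1/b, where kappa decreases; this contradicts
     [up]. *)
  have [r rE] : exists r, r = (M - s) / 2 by eexists.
  have [||z /andP[Mz _] [w /andP[w1 w2]]] := up a r ak al; rewrite ?xa; [lra|lra|].
  rewrite leNgt => /negP; apply; apply: kappa_decr => //; lra.
have kle a : a != k -> a != l -> 0 < coord x a -> kappa b (coord x a) <= kappa b M.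
  move=> ak al xa; rewrite leNgt; apply/negP => h.
  have M0 : 0 <= M by exact: x0.
  have [e e0 he] := kappa_gap b0 M0 xa (or_intror h).
  pose r := Num.min (e / 4) (coord x a / 2).
  have re : r <= e / 4 by rewrite ge_min lexx.
  have ra : r <= coord x a / 2 by rewrite ge_min lexx orbT.
  have r0 : 0 < r by rewrite lt_min !divr_gt0.
  have [||z /andP[Mz zr] [w /andP[w1 w2]]] := up a r ak al; [by []|lra|].
  rewrite leNgt => /negP; apply; apply: he.
  - exact: le_lt_trans Mz.
  - by rewrite ltr_norml; lra.
  - by rewrite ltr_norml; lra.
have [d d0 hd] : exists2 d, 0 < d & forall m, (m != k) && (m != l) ->
    coord x m + d <= M.
  by apply: (@finite_gap (fun m => (m != k) && (m != l))) => m /andP[]; exact: lt.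
have down a : a != k -> a != l ->
    ~ (coord x a = 0 \/ kappa b (coord x a) < kappa b M).
  move=> ak al h; have M0 : 0 < M by lra.
  have [e e0 he] := kappa_gap b0 (x0 a) M0 h.
  (* [e / 4] keeps the potentials ordered, [d / 4] keeps [k] and [l] maximal, and [M - s] keeps them
     at height at least [s]. *)
  pose r := Num.min (Num.min (e / 4) (d / 4)) (M - s).
  have re : r <= e / 4 by rewrite !ge_min lexx.
  have rd : r <= d / 4 by rewrite !ge_min lexx orbT.
  have rs : r <= M - s by rewrite !ge_min lexx orbT.
  have r0 : 0 < r by rewrite !lt_min !divr_gt0//= subr_gt0.
  have rM : r <= M by lra.
  have h' z w : coord x a < z < coord x a + 2 * r -> M - r < w < M ->
      kappa b z < kappa b w.
    move=> /andP[z1 z2] /andP[w1 w2]; apply: he.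
    - exact: le_lt_trans z1.
    - by rewrite ltr_norml; lra.
    - by rewrite ltr_norml; lra.
  have := F_triple_down b0 kl ak al Xx xkl r0 rM h'; rewrite ltNge xmin//.
  have had : coord x a + d <= M by apply: hd; rewrite ak.
  split.
  - apply/(XiP q0) => m; rewrite coord_triple//; case: ifP => _; first by rewrite -/M; lra.
    case: ifP => _; first by rewrite -xkl -/M; lra.
    by case: ifP => // _; have := x0 a; lra.
  - by rewrite !coord_triple// eqxx eq_sym (negPf kl) eqxx xkl.
  - move=> m; rewrite !coord_triple// eqxx; case: ifPn => // mk.
    case: ifPn => ml; first by rewrite -xkl.
    case: ifPn => ma; rewrite -/M; first lra.
    by have : coord x m + d <= M by [apply: hd; rewrite mk]; lra.
  - by rewrite coord_triple// eqxx -/M; lra.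
have pos a : a != k -> a != l -> 0 < coord x a.
  move=> ak al; rewrite lt_def x0 andbT; apply/eqP => xa.
  by apply: (down a ak al); left.
have keq a : a != k -> a != l -> kappa b (coord x a) = kappa b M.
  move=> ak al; apply/eqP; rewrite eq_le kle ?pos//= leNgt; apply/negP => h.
  by apply: (down a ak al); right.
have low a : a != k -> a != l -> coord x a < b^-1.
  move=> ak al; rewrite ltNge; apply/negP => h.
  by have := kappa_decr b0 h (lt a ak al); rewrite keq// ltxx.
have [c [ck cl]] : exists c, c != k /\ c != l.
  have [q1 q2] : (1 < q)%N /\ (2 < q)%N by lia.
  have [h0|h0] := boolP ((Ordinal q0 != k) && (Ordinal q0 != l)).
    by exists (Ordinal q0); apply/andP.
  have [h1|h1] := boolP ((Ordinal q1 != k) && (Ordinal q1 != l)).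
    by exists (Ordinal q1); apply/andP.
  exists (Ordinal q2); move: h0 h1; rewrite -!val_eqE /=; move: kl.
  by rewrite -val_eqE /=; move: (nat_of_ord k) (nat_of_ord l) => k' l'; lia.
have eqc m : m != k -> m != l -> coord x m = coord x c.
  move=> mk ml; have [h|h|//] := ltgtP (coord x m) (coord x c).
    by have := kappa_incr b0 (pos _ mk ml) h (ltW (low _ ck cl)); rewrite !keq// ltxx.
  by have := kappa_incr b0 (pos _ ck cl) h (ltW (low _ mk ml)); rewrite !keq// ltxx.
exists (coord x c); have xE := coord_eq_pt2 kl xkl eqc.
have ME : M = (1 - (q - 2)%N%:R * coord x c) / 2.
  by rewrite /M {1}xE coord_pt2// eqxx.
split=> //; last by rewrite /kdiff -ME keq// subrr.
rewrite pos //= -[ltRHS]div1r ltr_pdivlMr ?ltr0n//.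
have <- : 2 + (q - 2)%N%:R = q%:R :> R by apply: natr_sub; lia.
by have := lt c ck cl; rewrite mulrDr mulrC; lra.
Qed.

(** Compare [x] with a minimiser on the ridge. Either its energy is strictly larger, or [x] is a
    minimiser too and has the same form; this equality case later identifies the saddle points. *)
Lemma ridge_bound b s x k l : 0 < b -> k != l -> b^-1 <= s -> q%:R^-1 <= s ->
  ridge k l s x ->
  (exists y, [/\ ridge k l s y, coord y k = s & F b y <= F b x]) \/
  exists t, [/\ 0 < t < q%:R^-1, kdiff q 2 b t = 0 &
    Phi q 2 b t < F b x \/ x = pt2 q t k l].
Proof.
move=> b0 kl bs qs Kx.
have KX : ridge k l s `<=` @Xi R q by move=> y [].
have [|y Ky ymin] := @F_min R q q0 b _ (@closed_ridge k l s) KX; first by exists x.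
have [yk|yk] := eqVneq (coord y k) s; first by left; exists y; split=> //; exact: ymin.
have sy : s < coord y k by rewrite lt_def yk; case: Ky.
have [t [yE tI kt]] := ridge_min b0 kl bs qs Ky ymin sy.
have [lt|ge] := ltP (F b y) (F b x).
  by right; exists t; split=> //; left; rewrite -(F_pt2 q5 b t kl) -yE.
have xmin z : ridge k l s z -> F b x <= F b z.
  by move=> Kz; apply: le_trans ge (ymin z Kz).
have [xk|xk] := eqVneq (coord x k) s; first by left; exists x.
have sx : s < coord x k by rewrite lt_def xk; case: Kx.
have [t' [xE tI' kt']] := ridge_min b0 kl bs qs Kx xmin sx.
by right; exists t'; split=> //; right.
Qed.

End descent.

(** * The critical temperature beta3 *)

(* [G] is a minimum of affine functions: it is concave, and upper semicontinuous
   at the largest point where it is nonnegative. *)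
Lemma affine_min_unique_zero (R : realType) (a c0 : R) (G : R -> R)
    (A : set (R * R)) : a < c0 ->
  (forall b p, a <= b <= c0 -> A p -> G b <= b * p.1 + p.2) ->
  (forall b, a <= b <= c0 -> exists2 p, A p & G b = b * p.1 + p.2) ->
  0 < G a -> G c0 < 0 ->
  exists2 c, a < c < c0 & [/\ G c = 0, forall b, a <= b -> b < c -> 0 < G b &
    forall b, c < b -> b <= c0 -> G b < 0].
Proof.
move=> ac0 Gle Gex Ga Gc0.
have conc x y z : a <= x -> x < y -> y < z -> z <= c0 ->
    G x * (z - y) + G z * (y - x) <= G y * (z - x).
  move=> ax xy yz zc; have yI : a <= y <= c0 by apply/andP; split; lra.
  have [p Ap ->] := Gex y yI.
  have xI : a <= x <= c0 by apply/andP; split; lra.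
  have zI : a <= z <= c0 by apply/andP; split; lra.
  have hx := Gle x p xI Ap; have hz := Gle z p zI Ap.
  have : G x * (z - y) <= (x * p.1 + p.2) * (z - y) by rewrite ler_pM2r; lra.
  have : G z * (y - x) <= (z * p.1 + p.2) * (y - x) by rewrite ler_pM2r; lra.
  have -> : (y * p.1 + p.2) * (z - x) =
    (x * p.1 + p.2) * (z - y) + (z * p.1 + p.2) * (y - x) by ring.
  lra.
pose S := [set x | a <= x <= c0 /\ 0 <= G x].
have Sa : S a by rewrite /S /= lexx !ltW.
have hS : has_sup S by split; [exists a|exists c0 => x [/andP[]]].
pose c := sup S.
have ac : a <= c by exact: sup_upper_bound.
have cc0 : c <= c0 by apply: ge_sup; [exists a|move=> x [/andP[]]].
have cI : a <= c <= c0 by rewrite ac.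
have above b : c < b -> b <= c0 -> G b < 0.
  move=> cb bc0; rewrite ltNge; apply/negP => Gb.
  have : S b by split=> //; apply/andP; split=> //; lra.
  by move=> /(sup_upper_bound hS); rewrite leNgt cb.
have Gc : 0 <= G c.
  (* The affine function equal to [G] at [c] dominates [G]. If it were negative at [c], it would be
     negative at nearby points of [S], where [G] is nonnegative. *)
  rewrite leNgt; apply/negP => Gc; have [p Ap Ep] := Gex c cI.
  have n1 : 0 < `|p.1| + 1 by rewrite ltr_wpDl.
  have d0 : 0 < - G c / (`|p.1| + 1) by rewrite divr_gt0// oppr_gt0.
  have [x [xI Gx] cx] := sup_adherent d0 hS; rewrite -/c in cx.
  have xc : x <= c by exact: sup_upper_bound.
  have := Gle x p xI Ap.
  have -> : x * p.1 + p.2 = G c - (c - x) * p.1 by rewrite Ep; ring.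
  have : - ((c - x) * p.1) <= (c - x) * (`|p.1| + 1).
    rewrite -mulrN ler_wpM2l ?subr_ge0//.
    by have := ler_norm (- p.1); rewrite normrN; lra.
  have : (c - x) * (`|p.1| + 1) < - G c by rewrite -ltr_pdivlMr//; lra.
  lra.
have cltc0 : c < c0 by rewrite lt_neqAle cc0 andbT; apply: contraTneq Gc => ->; rewrite -ltNge.
have Gc_eq : G c = 0.
  apply/eqP; rewrite eq_le Gc andbT leNgt; apply/negP => Gcp.
  have d0 : 0 < G c - G c0 by lra.
  (* At [y] the chord of [G] from [c] to [c0] has the value G(c)/2 > 0, whereas [G y] is
     negative. *)
  pose y := c + (c0 - c) * (G c / (2 * (G c - G c0))).
  have r0 : 0 < G c / (2 * (G c - G c0)) by rewrite divr_gt0// mulr_gt0.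
  have r1 : G c / (2 * (G c - G c0)) < 1 by rewrite ltr_pdivrMr ?mulr_gt0//; lra.
  have [d dE] : exists d, d = c0 - c by eexists.
  have dp : 0 < d by lra.
  have [r rE] : exists r, r = G c / (2 * (G c - G c0)) by eexists.
  have yE : y = c + d * r by rewrite /y dE rE.
  have cy : c < y by rewrite yE ltrDl mulr_gt0// rE.
  have yc0 : y < c0.
    have : d * r < d * 1 by rewrite ltr_pM2l// rE.
    by rewrite yE; lra.
  have := conc c y c0 ac cy yc0 (lexx _); have := above y cy (ltW yc0) => Gy.
  have : G y * (c0 - c) < 0 by rewrite nmulr_rlt0// subr_gt0.
  have -> : c0 - y = d * (1 - r) by rewrite yE dE; ring.
  have -> : y - c = d * r by rewrite yE; ring.
  have -> : G c * (d * (1 - r)) + G c0 * (d * r) = d * (G c - (G c - G c0) * r) by ring.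
  have -> : (G c - G c0) * r = G c / 2 by rewrite rE; field; rewrite gt_eqF.
  have : 0 < d * (G c - G c / 2) by rewrite mulr_gt0//; lra.
  lra.
have altc : a < c by rewrite lt_neqAle ac andbT; apply: contraTneq Ga => ->; rewrite Gc_eq ltxx.
exists c; first by rewrite altc.
split=> // b ab bc; have [->//|na] := eqVneq b a.
have ab' : a < b by rewrite lt_def na.
have := conc a b c (lexx _) ab' bc cc0; rewrite Gc_eq mul0r addr0 => h.
rewrite -(pmulr_lgt0 _ (_ : 0 < c - a)) ?subr_gt0//.
by apply: lt_le_trans h; rewrite mulr_gt0// subr_gt0.
Qed.

Section critical.
Context {R : realType}.
Variable q : nat.
Hypothesis q5 : (5 <= q)%N.
Implicit Types (x y : 'rV[R]_q.-1) (b t r s : R) (k l m a c : 'I_q).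

Let q0 : (0 < q)%N. Proof. by case: q q5. Qed.
Let one0 : (0 < 1)%N. Proof. by []. Qed.
Let two0 : (0 < 2)%N. Proof. by []. Qed.
Let i1q : (2 * 1 < q)%N. Proof. by lia. Qed.
Let i2q : (2 * 2 < q)%N. Proof. by lia. Qed.
Let lt1q : (1 < q)%N. Proof. by lia. Qed.
Let Qp : 0 < q%:R :> R. Proof. by rewrite ltr0n. Qed.

Definition major1 t := 1 - (q - 1)%N%:R * t.
Definition major2 t := (1 - (q - 2)%N%:R * t) / 2.

Lemma lt_invq (i : nat) t : (i < q)%N -> t < q%:R^-1 -> t < (q - i)%N%:R^-1.
Proof.
move=> iq tq; apply: lt_le_trans tq _.
by rewrite lef_pV2 ?posrE ?ltr0n ?subn_gt0// ler_nat leq_subr.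
Qed.

Lemma major1_gt t : t < q%:R^-1 -> t < major1 t /\ q%:R^-1 < major1 t.
Proof.
move=> tq; have E : 1%:R + (q - 1)%N%:R = q%:R :> R by apply: natr_sub.
have h : t * q%:R < 1 by rewrite -ltr_pdivlMr// div1r.
have n0 : 0 < (q - 1)%N%:R :> R by rewrite ltr0n subn_gt0.
have h2 : (q - 1)%N%:R * t < (q - 1)%N%:R * q%:R^-1 by rewrite ltr_pM2l.
have e : (q - 1)%N%:R * q%:R^-1 = 1 - q%:R^-1 :> R.
  by rewrite -[(q - 1)%N%:R](addKr 1%:R) E mulrDl divff ?gt_eqF//; lra.
by rewrite /major1; split; lra.
Qed.

Let natr2_invq : (q - 2)%N%:R * q%:R^-1 = 1 - 2 * q%:R^-1 :> R.
Proof.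
have E : 2%:R + (q - 2)%N%:R = q%:R :> R by apply: natr_sub.
by rewrite -[(q - 2)%N%:R](addKr 2%:R) E mulrDl divff ?gt_eqF//; lra.
Qed.

Lemma major2_gt t : t < q%:R^-1 -> t < major2 t /\ q%:R^-1 < major2 t.
Proof.
move=> tq; have n0 : 0 < (q - 2)%N%:R :> R by rewrite ltr0n subn_gt0.
have h2 : (q - 2)%N%:R * t < (q - 2)%N%:R * q%:R^-1 by rewrite ltr_pM2l.
have e := natr2_invq.
by rewrite /major2; split; lra.
Qed.

Lemma major1E t : major1 t = 2 * major2 t - t.
Proof.
have e1 : (q - 1)%N%:R = q%:R - 1%:R :> R by rewrite natrB.
have e2 : (q - 2)%N%:R = q%:R - 2%:R :> R by rewrite natrB.
by rewrite /major1 /major2 e1 e2; field.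
Qed.

Lemma major2_inj t : (q - 2)%N%:R * t = 1 - 2 * major2 t.
Proof. by rewrite /major2; field. Qed.

Lemma kappa_above b t s : 0 < b -> 0 < t -> t < s -> kappa b t = kappa b s ->
  b^-1 < s.
Proof.
move=> b0 t0 ts e; rewrite ltNge; apply/negP => sb.
by have := kappa_incr b0 t0 ts sb; rewrite e ltxx.
Qed.

Lemma kdiff1E b t : kdiff q 1 b t = kappa b t - kappa b (major1 t).
Proof. by rewrite /kdiff divr1. Qed.

Lemma kdiff2E b t : kdiff q 2 b t = kappa b t - kappa b (major2 t).
Proof. by []. Qed.

(* At a critical point (S, S, T, ..., T) the pair (S, S) can be spread apart to
   (S + r, S - r), lowering the energy up to the point (2S - T, T, ..., T). *)
Section spread.
Variables (b t : R) (k l : 'I_q).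
Hypotheses (b0 : 0 < b) (tI : 0 < t < q%:R^-1) (kl : k != l).
Hypothesis kt : kdiff q 2 b t = 0.

Let S := major2 t.

Let tS : t < S. Proof. by case/andP: tI => _ /major2_gt[]. Qed.

Let keq : kappa b t = kappa b S.
Proof. by apply/eqP; rewrite -subr_eq0 -kdiff2E kt. Qed.

Lemma coord_spread r m : coord (move (pt2 q t k l) (pair_dir k l) r) m =
  if m == k then S + r else if m == l then S - r else t.
Proof.
rewrite coord_pair// !coord_pt2// !eqxx orbT /=.
by case: eqP => // _; case: eqP.
Qed.

(** The potential is below [kappa b S] on (S, S + r), as S > 1/b, and above it on (S - r, S), by
    quasiconcavity between [t] and [S], whose potentials agree. *)
Lemma spread_lt r : 0 < r -> r <= S - t ->
  F b (move (pt2 q t k l) (pair_dir k l) r) < F b (pt2 q t k l).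
Proof.
move=> r0 rS; have /andP[t0 tq] := tI; have tS' := tS; have ke := keq.
have tq' : t < (q - 2)%N%:R^-1 by apply: lt_invq.
have Sb := kappa_above b0 t0 tS ke.
apply: F_pair_lt => //; first by apply: Xi_pt2 => //; exact: ltW.
  by rewrite coord_pt2// eqxx orbT -/(major2 t) -/S; lra.
rewrite !coord_pt2// !eqxx orbT /= -/(major2 t) -/S.
move=> z w /andP[z1 z2] /andP[w1 w2].
have zS : kappa b z < kappa b S by apply: kappa_decr => //; exact: ltW.
apply: (lt_trans zS).
have tw : t < w by lra.
by case: (kappa_mid b0 t0 tw w2) => //; rewrite ke.
Qed.

Lemma spread_Xi r : 0 <= r -> r <= S - t -> Xi (move (pt2 q t k l) (pair_dir k l) r).
Proof.
move=> r0 rS; have /andP[t0 tq] := tI; have tS' := tS.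
have tq' : t < (q - 2)%N%:R^-1 by apply: lt_invq.
apply: Xi_pair => //; first by apply: Xi_pt2 => //; exact: ltW.
by rewrite coord_pt2// eqxx orbT -/(major2 t) -/S; lra.
Qed.

Lemma spread_end : move (pt2 q t k l) (pair_dir k l) (S - t) = pt1 q t k.
Proof.
apply: coord_eq_pt1 => // m mk; rewrite coord_spread (negPf mk).
by case: ifP => // _; rewrite opprB addrC subrK.
Qed.

(** The full spread ends at height 2S - t > S, where the potential is lower still. This sign is what
    places u_2 relative to u_1 and v_1. *)
Lemma spread_kdiff1 : 0 < kdiff q 1 b t.
Proof.
have /andP[t0 tq] := tI; have tS' := tS; have Sb := kappa_above b0 t0 tS keq.
rewrite kdiff1E subr_gt0 keq; apply: kappa_decr => //; first exact: ltW.
by rewrite major1E -/S; lra.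
Qed.

End spread.

Section extremal.
Variable i : nat.
Hypotheses (i0 : (0 < i)%N) (iq : (2 * i < q)%N).

(** [tau] does not depend on [b]: the minimum and the maximum are taken over fixed ranges, as needed
    to see both as extrema of one family of affine functions of [b]. *)
Lemma Phi_extremal : exists2 tau, 0 < tau < q%:R^-1 &
  forall b, beta_s R q i <= b -> b <= q%:R ->
  [/\ 0 < u q i b <= tau, tau <= v q i b <= q%:R^-1,
      forall t, 0 < t -> t <= tau -> Phi q i b (u q i b) <= Phi q i b t &
      forall t, tau <= t -> t <= q%:R^-1 -> Phi q i b t <= Phi q i b (v q i b)].
Proof.
have [tau tauI [bs0 bsQ _ h]] := profile (R := R) i0 iq.
have iq' : (i < q)%N by lia.
exists tau => // b bs bQ; have [_ /(_ bs) [uI ku klow] hv _ hQ] := h b.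
have /andP[tau0 tauQ] := tauI; have /andP[u0 utau] := uI.
have b0 : 0 < b by exact: lt_le_trans bs.
have left t : 0 < t -> t < u q i b -> Phi q i b (u q i b) < Phi q i b t.
  move=> t0 tu; apply: Phi_decr => //.
    by apply: lt_invq => //; exact: le_lt_trans tauQ.
  by move=> z tz zu; apply: klow => //; exact: lt_trans tz.
have QJ : q%:R^-1 < (q - i)%N%:R^-1 :> R.
  by rewrite ltf_pV2 ?posrE ?ltr0n ?subn_gt0// ltr_nat ltn_subrL i0.
have [bQ'|bQ'] := ltP b q%:R.
  have [/andP[tauv vQ] _ kmid kright] := hv bs bQ'.
  have mid t t' : u q i b <= t -> t < t' -> t' <= v q i b ->
      Phi q i b t < Phi q i b t'.
    move=> ut tt' t'v; apply: Phi_incr => //; first exact: lt_le_trans ut.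
      by apply: lt_invq => //; exact: le_lt_trans vQ.
    by move=> z tz zt'; apply: kmid; [exact: le_lt_trans tz|exact: lt_le_trans t'v].
  split=> //; first by rewrite tauv ltW.
  - move=> t t0 ttau; have [tu|ut|->//] := ltgtP t (u q i b).
      by apply: ltW; exact: left.
    by apply: ltW; apply: mid => //; exact: le_trans tauv.
  - move=> t taut tQ; have [tv|vt|->//] := ltgtP t (v q i b).
      by apply: ltW; apply: mid => //; exact: le_trans taut.
    apply: ltW; apply: Phi_decr => //.
    + exact: lt_le_trans tauv.
    + exact: le_lt_trans QJ.
    + by move=> z vz zt; apply: kright => //; exact: lt_le_trans tQ.
(* At b = q the point v is 1/q, and the energy increases all the way from u to it. *)
have bE : b = q%:R by apply/eqP; rewrite eq_le bQ.
have [kr /(_ bE) vE _] := hQ bQ'.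
have mid t t' : u q i b <= t -> t < t' -> t' <= q%:R^-1 ->
    Phi q i b t < Phi q i b t'.
  move=> ut tt' t'v; apply: Phi_incr => //; first exact: lt_le_trans ut.
    exact: le_lt_trans QJ.
  by move=> z tz zt'; apply: kr; [exact: le_lt_trans tz|exact: lt_le_trans t'v].
split=> //; first by rewrite vE lexx ltW.
- move=> t t0 ttau; have [tu|ut|->//] := ltgtP t (u q i b).
    by apply: ltW; exact: left.
  by apply: ltW; apply: mid => //; exact: le_trans (ltW tauQ).
- move=> t taut tQ; rewrite vE; have [tv|vt|->//] := ltgtP t q%:R^-1.
    by apply: ltW; apply: mid => //; exact: le_trans taut.
  by rewrite leNgt vt in tQ.
Qed.

End extremal.

Lemma v1_facts b : beta_s R q 1 <= b -> b < q%:R ->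
  [/\ 0 < b, 0 < v q 1 b, v q 1 b < q%:R^-1,
      kappa b (v q 1 b) = kappa b (major1 (v q 1 b)) &
      b^-1 < major1 (v q 1 b)].
Proof.
move=> bs bQ; have [tau /andP[tau0 tauQ] [bs0 _ _ h]] := profile (R := R) one0 i1q.
have [_ _ /(_ bs bQ) [/andP[tv vQ] kv _ _] _ _] := h b.
have b0 : 0 < b by exact: lt_le_trans bs.
have v0 : 0 < v q 1 b by exact: lt_le_trans tv.
have ke : kappa b (v q 1 b) = kappa b (major1 (v q 1 b)).
  by apply/eqP; rewrite -subr_eq0 -kdiff1E kv.
have [vs _] := major1_gt vQ.
by split=> //; exact: kappa_above ke.
Qed.

Lemma u2_facts b : beta_s R q 2 <= b ->
  [/\ 0 < b, 0 < u q 2 b < q%:R^-1 & kdiff q 2 b (u q 2 b) = 0].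
Proof.
move=> bs; have [tau /andP[tau0 tauQ] [bs0 _ _ h]] := profile (R := R) two0 i2q.
have [_ /(_ bs) [/andP[u0 ut] ku _] _ _ _] := h b.
split=> //; first exact: lt_le_trans bs.
by rewrite u0; exact: le_lt_trans tauQ.
Qed.

Lemma F_ge_v1 b x k : beta_s R q 1 <= b -> b < q%:R -> Xi x ->
  coord x k = major1 (v q 1 b) -> (forall m, coord x m <= coord x k) ->
  x <> v1pt q b k -> Phi q 1 b (v q 1 b) < F b x.
Proof.
move=> bs bQ Xx xk xm xn; have [b0 v0 vQ ke _] := v1_facts bs bQ.
have [vs _] := major1_gt vQ.
by apply: F_pt1_min xk xm _ => //; apply/eqP.
Qed.

Lemma kdiff1_gt0 b t : 0 < t -> t < q%:R^-1 -> 0 < kdiff q 1 b t ->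
  beta_s R q 1 <= b /\ u q 1 b < t /\ (b < q%:R -> t < v q 1 b).
Proof.
move=> t0 tQ kt; have [tau /andP[tau0 tauQ] [bs0 _ _ h]] := profile (R := R) one0 i1q.
have [hlt hu hv _ _] := h b.
have bs : beta_s R q 1 <= b.
  by rewrite leNgt; apply/negP => /hlt /(_ _ t0 tQ); rewrite ltNge ltW.
have [uI ku klow] := hu bs.
split=> //; split.
  rewrite ltNge le_eqVlt; apply/negP => /predU1P[e|tu].
    by move: kt; rewrite e ku ltxx.
  by have := klow _ t0 tu; rewrite ltNge ltW.
move=> bQ; have [_ kv _ kr] := hv bs bQ.
rewrite ltNge le_eqVlt; apply/negP => /predU1P[e|vt].
  by move: kt; rewrite -e kv ltxx.
by have := kr _ vt tQ; rewrite ltNge ltW.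
Qed.

(** At u_2(beta_{s,2}) the first [kdiff] is positive, so g_1 takes a value below beta_{s,2}. *)
Lemma beta_s12 : beta_s R q 1 <= beta_s R q 2.
Proof.
have [b0 uI ku] := u2_facts (lexx _); have /andP[u0 uQ] := uI.
have kl : Ordinal q0 != Ordinal (leq_trans (isT : (1 < 5)%N) q5) by [].
by case: (kdiff1_gt0 u0 uQ (spread_kdiff1 b0 uI ku)).
Qed.

(* Some point whose largest coordinate is [s], hence with energy at least that of
   [v1], lies on a descending path from [u2]: the line of the [pt2 q t k l] when
   [s <= major2 T], the spreading of [major2 T, major2 T] otherwise. *)
Lemma F_v1_lt_u2_start :
  Phi q 1 (beta_s R q 2) (v q 1 (beta_s R q 2)) <
  Phi q 2 (beta_s R q 2) (u q 2 (beta_s R q 2)).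
Proof.
set b := beta_s R q 2.
have [tau _ [_ bQ knp _]] := profile (R := R) two0 i2q.
have [b0 uI ku] := u2_facts (lexx (beta_s R q 2)); have /andP[u0 uQ] := uI.
have [_ v0 vQ ke _] := v1_facts beta_s12 bQ.
rewrite -/b in bQ knp b0 uI ku u0 uQ v0 vQ ke *.
have [vs Qs] := major1_gt vQ.
set s := major1 (v q 1 b) in vs Qs ke; set T := u q 2 b in uI ku u0 uQ *.
pose k := Ordinal q0; pose l := Ordinal (leq_trans (isT : (1 < 5)%N) q5).
have kl : k != l by [].
have n2 : 0 < (q - 2)%N%:R :> R by rewrite ltr0n subn_gt0.
have [TS _] := major2_gt uQ.
have [sS|Ss] := leP s (major2 T).
  have [t tE] : exists t, t = (1 - 2 * s) / (q - 2)%N%:R by eexists.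
  (* [t] is chosen for this: the two large coordinates of the [pt2] point sit at the height of
     v1. *)
  have st : major2 t = s by rewrite /major2 tE; field; rewrite gt_eqF.
  have Tt : T <= t.
    by rewrite -(ler_pM2l n2) !major2_inj st; lra.
  have tQ : t < q%:R^-1.
    by rewrite -(ltr_pM2l n2) major2_inj st natr2_invq; lra.
  have t0 : 0 < t by exact: lt_le_trans Tt.
  have tJ : t < (q - 2)%N%:R^-1 by apply: lt_invq.
  have [ts _] := major2_gt tQ; rewrite st in ts.
  apply: (@lt_le_trans _ _ (F b (pt2 q t k l))).
    apply: (F_ge_v1 (k := k)) => //; first exact: beta_s12.
    - by apply: Xi_pt2 => //; exact: ltW.
    - by rewrite coord_pt2// -/(major2 t) st.
    - move=> m; rewrite !coord_pt2// -/(major2 t) st eqxx /=.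
      by case: ifP => // _; exact: ltW.
    - move/(f_equal (fun x => coord x l)).
      rewrite coord_pt2// coord_pt1// eqxx orbT -/(major2 t) st /=.
      by move=> e; rewrite e ltxx in vs.
  rewrite F_pt2//; apply: Phi_noninc => // z Tz zt; apply: knp.
    exact: lt_trans Tz.
  exact: lt_trans tQ.
have k1 := spread_kdiff1 b0 uI ku.
have [_ [_ /(_ bQ) Tv]] := kdiff1_gt0 u0 uQ k1.
have sT : s < 2 * major2 T - T.
  by rewrite -major1E /s /major1 ltrD2l ltrN2 ltr_pM2l// ltr0n subn_gt0 lt1q.
pose r := s - major2 T.
have r0 : 0 < r by rewrite subr_gt0.
have rS : r <= major2 T - T by rewrite /r; lra.
have := spread_lt b0 uI kl ku r0 rS; rewrite (F_pt2 q5 _ _ kl).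
apply: le_lt_trans.
set x := move _ _ _.
have [->|xn] := pselect (x = v1pt q b k); first by rewrite F_pt1.
apply: ltW; apply: (F_ge_v1 (k := k)) => //; first exact: beta_s12.
- by apply: spread_Xi => //; exact: ltW.
- by rewrite /x coord_spread// eqxx /r addrC subrK.
- move=> m; rewrite /x !coord_spread// eqxx.
  by case: ifP => // _; case: ifP => _; lra.
Qed.

(** At b = q the point v1 is p, and the line of u2 climbs from u2 to p. *)
Lemma F_u2_lt_v1_end :
  Phi q 2 q%:R (u q 2 q%:R) < Phi q 1 q%:R (v q 1 q%:R) :> R.
Proof.
set b : R := q%:R.
have [tau _ [_ bs1 _ /(_ b) [_ _ _ _ /(_ (lexx _)) [_ /(_ erefl) -> _]]]] :=
  profile (R := R) one0 i1q.
have [tau' _ [_ bs _ /(_ b) [_ _ _ _ /(_ (lexx _)) [kr _ _]]]] :=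
  profile (R := R) two0 i2q.
have [b0 /andP[u0 uQ] _] := u2_facts (ltW bs).
rewrite -F_pp1// F_pp2//; apply: Phi_incr => //.
by rewrite ltf_pV2 ?posrE ?ltr0n ?subn_gt0 ?ltr_nat; lia.
Qed.

Lemma F_v1E b : F b (v1 q b) = Phi q 1 b (v q 1 b).
Proof.
have q1 : (q.-1 < q)%N by lia.
by rewrite /v1 /v1pt (F_pt1 q5 _ _ (Ordinal q1)).
Qed.

Lemma F_u2E b : F b (u2 q b) = Phi q 2 b (u q 2 b).
Proof.
have q1 : (q.-1 < q)%N by lia.
have q2 : (q.-2 < q)%N by lia.
rewrite /u2 /u2pt (F_pt2 q5 _ _ (k := Ordinal q2) (l := Ordinal q1))//.
by rewrite -val_eqE /=; lia.
Qed.

(** * The energy difference as a function of b *)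

Definition Phi_slope (i : nat) t : R :=
  - (2^-1 * (i%:R * ((1 - (q - i)%N%:R * t) / i%:R) ^+ 2 + (q - i)%N%:R * t ^+ 2)).

Definition Phi_intercept (i : nat) t : R :=
  i%:R * ((1 - (q - i)%N%:R * t) / i%:R * ln ((1 - (q - i)%N%:R * t) / i%:R)) +
  (q - i)%N%:R * (t * ln t).

Lemma Phi_affine i b t : b != 0 ->
  b * Phi q i b t = b * Phi_slope i t + Phi_intercept i t.
Proof.
move=> b0; rewrite /Phi /Phi_slope /Phi_intercept /phi.
by set s := _ / i%:R; move: s => s; field.
Qed.

Lemma beta3P : [/\ beta_s R q 2 < beta3 R q < q%:R,
  Phi q 1 (beta3 R q) (v q 1 (beta3 R q)) = Phi q 2 (beta3 R q) (u q 2 (beta3 R q)),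
  forall b, beta_s R q 2 <= b -> b < beta3 R q ->
    Phi q 1 b (v q 1 b) < Phi q 2 b (u q 2 b) &
  forall b, beta3 R q < b -> b <= q%:R ->
    Phi q 2 b (u q 2 b) < Phi q 1 b (v q 1 b)].
Proof.
have [tau1 tau1I h1] := Phi_extremal one0 i1q.
have [tau2 tau2I h2] := Phi_extremal two0 i2q.
have [_ _ [bs0 bsQ _ _]] := profile (R := R) two0 i2q.
pose G b := b * (Phi q 2 b (u q 2 b) - Phi q 1 b (v q 1 b)).
(* The minimum over [t] of the second line minus the maximum over [t'] of the first is one minimum
   over pairs, hence over the affine functions in [A]. *)
pose A := [set p : R * R | exists t t', [/\ 0 < t <= tau2, tau1 <= t' <= q%:R^-1 &
   p = (Phi_slope 2 t - Phi_slope 1 t', Phi_intercept 2 t - Phi_intercept 1 t')]].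
have GA b t t' : b != 0 -> b * (Phi q 2 b t - Phi q 1 b t') =
    b * (Phi_slope 2 t - Phi_slope 1 t') + (Phi_intercept 2 t - Phi_intercept 1 t').
  by move=> b0; rewrite mulrBr !Phi_affine//; ring.
have bs12 := beta_s12.
have [||||c /andP[ac cQ] [Gc Glt Ggt]] :=
    @affine_min_unique_zero R (beta_s R q 2) q%:R G A bsQ.
- move=> b _ /andP[bs bQ] [t [t' [/andP[t0 tt] /andP[tt' t'Q] ->]]] /=.
  have b0 : 0 < b by exact: lt_le_trans bs.
  have [_ _ _ hv] := h1 b (le_trans bs12 bs) bQ.
  have [_ _ hu _] := h2 b bs bQ.
  rewrite -GA ?gt_eqF// ler_pM2l//.
  by have := hv t' tt' t'Q; have := hu t t0 tt; lra.
- move=> b /andP[bs bQ]; have b0 : 0 < b by exact: lt_le_trans bs.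
  have [_ vI _ _] := h1 b (le_trans bs12 bs) bQ.
  have [uI _ _ _] := h2 b bs bQ.
  exists (Phi_slope 2 (u q 2 b) - Phi_slope 1 (v q 1 b),
          Phi_intercept 2 (u q 2 b) - Phi_intercept 1 (v q 1 b)).
    by exists (u q 2 b), (v q 1 b).
  by rewrite /G GA ?gt_eqF.
- by rewrite /G mulr_gt0// subr_gt0; exact: F_v1_lt_u2_start.
- by rewrite /G pmulr_rlt0// subr_lt0; exact: F_u2_lt_v1_end.
have Gsign b : beta_s R q 2 <= b ->
    (0 < G b) = (Phi q 1 b (v q 1 b) < Phi q 2 b (u q 2 b)).
  by move=> bs; rewrite /G pmulr_rgt0 ?subr_gt0//; exact: lt_le_trans bs.
have Gsign' b : beta_s R q 2 <= b ->
    (G b < 0) = (Phi q 2 b (u q 2 b) < Phi q 1 b (v q 1 b)).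
  by move=> bs; rewrite /G pmulr_rlt0 ?subr_lt0//; exact: lt_le_trans bs.
have c0 : 0 < c by exact: lt_trans ac.
have ceq : Phi q 1 c (v q 1 c) = Phi q 2 c (u q 2 c).
  move/eqP: Gc; rewrite /G mulf_eq0 gt_eqF//= subr_eq0 => /eqP ->//.
(* Uniqueness makes the choice in [beta3] return [c] and not its default value q. *)
have cu : unique (@beta3_eqn R q) c.
  split; first by rewrite /beta3_eqn ac cQ F_v1E F_u2E.
  move=> b [/andP[ab bQ]]; rewrite F_v1E F_u2E => e.
  have [cb|bc|//] := ltgtP c b.
    by have := Ggt b cb (ltW bQ); rewrite Gsign' ?ltW// e ltxx.
  by have := Glt b (ltW ab) bc; rewrite Gsign ?ltW// e ltxx.
have -> : beta3 R q = c.
  by apply: xget_unique => // b [eb _]; case: cu => _ /(_ b eb).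
split=> //; first by rewrite ac.
- by move=> b ab bc; rewrite -Gsign// Glt.
- by move=> b cb bQ; rewrite -Gsign' ?Ggt// (ltW (lt_trans ac cb)).
Qed.

End critical.

(** * Wells and saddle points *)

Lemma connected_between (T : topologicalType) (C B : set T) :
  connected C -> C `<=` B -> B `<=` closure C -> connected B.
Proof.
move=> Cc CB BC E [e Ee] [U Uo EU] [K Kc EK].
have CK : C `&` U = C.
  apply: Cc.
  - have [Be Oe] : (B `&` U) e by rewrite -EU.
    by have [z [Cz Oz]] := BC e Be U (open_nbhs_nbhs (conj Uo Oe)); exists z.
  - by exists U.
  - exists K => //; apply/seteqP; split=> z [Cz h]; split=> //.
      by have [] : (B `&` K) z by rewrite -EK EU; split=> //; exact: CB.
    by have [] : (B `&` U) z by rewrite -EU EK; split=> //; exact: CB.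
have {}CK : C `<=` K.
  move=> z Cz; have [_ Oz] : (C `&` U) z by rewrite CK.
  by have [] : (B `&` K) z by rewrite -EK EU; split=> //; exact: CB.
rewrite EK; apply/seteqP; split=> z; first by case.
by move=> Bz; split=> //; apply: Kc; apply: closureS CK _ (BC z Bz).
Qed.

(** Adding a closure point keeps a connected set connected. So a minimiser over the closure of a
    component lies in the component as soon as it is in the sublevel set. *)
Lemma component_relatively_closed (T : topologicalType) (A : set T) (x y : T) :
  A y -> closure (connected_component A x) y -> connected_component A x y.
Proof.
move=> Ay cy; set C := connected_component A x.
have [Ax|nAx] := pselect (A x); last first.
  by move: cy; rewrite connected_component_out// closure0.
apply: (@connected_component_max _ A (C `|` [set y])).
- by left; exact: connected_component_refl.
- by move=> z [/connected_component_sub//|->].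
- apply: (@connected_between _ C); first exact: component_connected.
    by move=> z Cz; left.
  by move=> z [/subset_closure//|->].
- by right.
Qed.

(** For a saddle [x], which lies on the level and hence outside the sublevel set, while the rest of
    the segment is inside. *)
Lemma half_open_segment (R : realType) n (A : set 'rV[R]_n) (x y : 'rV[R]_n) :
  (forall r, 0 < r <= 1 -> A (x + r *: (y - x))) ->
  closure (connected_component A y) x.
Proof.
move=> h; apply: (@segment_closure _ _ _ x y) => r /andP[r0 r1].
apply: segment_component => p /andP[p0 p1].
have -> : y + p *: (x + r *: (y - x) - y) = x + (1 - p * (1 - r)) *: (y - x).
  by apply/rowP => j; rewrite !mxE; ring.
have pr : p * (1 - r) <= 1 * (1 - r) by rewrite ler_wpM2r ?subr_ge0.
have pr0 : 0 <= p * (1 - r) by rewrite mulr_ge0 ?subr_ge0.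
by apply: h; lra.
Qed.

Section wells.
Context {R : realType}.
Variable q : nat.
Hypothesis q5 : (5 <= q)%N.
Implicit Types (x y : 'rV[R]_q.-1) (b t r s h : R) (k l m : 'I_q).

Let q0 : (0 < q)%N. Proof. by case: q q5. Qed.
Let one0 : (0 < 1)%N. Proof. by []. Qed.
Let two0 : (0 < 2)%N. Proof. by []. Qed.
Let i1q : (2 * 1 < q)%N. Proof. by lia. Qed.
Let i2q : (2 * 2 < q)%N. Proof. by lia. Qed.
Let lt1q : (1 < q)%N. Proof. by lia. Qed.
Let Qp : 0 < q%:R :> R. Proof. by rewrite ltr0n. Qed.
Let Qi : 0 < q%:R^-1 :> R. Proof. by rewrite invr_gt0. Qed.
Let QJ : q%:R^-1 < (q - 1)%N%:R^-1 :> R.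
Proof. by rewrite ltf_pV2 ?posrE ?ltr0n ?subn_gt0// ltr_nat ltn_subrL. Qed.

(** * Open regions containing the wells *)

Lemma coord_near_lt x s : (forall m, coord x m < s) ->
  nbhs x [set y | forall m, coord y m < s].
Proof.
move=> h; apply: (@filter_forall _ _ (fun m y => coord y m < s) (nbhs x)) => m.
have := @continuous_coord R q m x.
move=> /cvgrPdist_lt /(_ (s - coord x m)); rewrite subr_gt0 => /(_ (h m)).
apply: filterS => y /=; rewrite ltr_norml => /andP[]; lra.
Qed.

Lemma open_all_lt s : open [set x : 'rV[R]_q.-1 | forall m, coord x m < s].
Proof. by rewrite openE => x; exact: coord_near_lt. Qed.

Lemma closed_all_le s : closed [set x : 'rV[R]_q.-1 | forall m, coord x m <= s].
Proof.
move=> x cx m.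
have cs : {for x, continuous (fun _ : 'rV[R]_q.-1 => s : R)}.
  by move=> B; exact: (@cst_continuous 'rV[R]_q.-1 R s x B).
by apply: (closure_le (@continuous_coord R q m x) cs _ cx).
Qed.

(** With [weakly_dominated], the open and closed regions for [connected_clopen]: they differ only in
    points whose largest coordinate is at height [s] or attained twice. *)
Definition dominated k s : set 'rV[R]_q.-1 :=
  [set x | s < coord x k /\ forall l, l != k -> coord x l < coord x k].

Definition weakly_dominated k s : set 'rV[R]_q.-1 :=
  [set x | s <= coord x k /\ forall l, coord x l <= coord x k].

Lemma open_dominated k s : open (dominated k s).
Proof.
rewrite openE => x [xs xk].
have ck := @continuous_coord R q k x.
have h1 : nbhs x [set y | s < coord y k].
  move: ck => /cvgrPdist_lt /(_ (coord x k - s)); rewrite subr_gt0 => /(_ xs).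
  by apply: filterS => y /=; rewrite ltr_norml => /andP[]; lra.
have h2 : nbhs x [set y | forall l, l != k -> coord y l < coord y k].
  apply: (@filter_forall _ _ (fun l y => l != k -> coord y l < coord y k) (nbhs x)).
  move=> l; have [lk|lk] := eqVneq l k; first by apply: filterE => y /eqP.
  have d : {for x, continuous (fun y : 'rV[R]_q.-1 => coord y k - coord y l)}.
    exact: cvgB ck (@continuous_coord R q l x).
  move: d => /cvgrPdist_lt /(_ (coord x k - coord x l)); rewrite subr_gt0.
  move=> /(_ (xk l lk)); apply: filterS => y /= h _; move: h.
  by rewrite ltr_norml => /andP[]; lra.
by apply: filterS2 h1 h2 => y.
Qed.

Lemma closed_weakly_dominated k s : closed (weakly_dominated k s).
Proof.
move=> x cx; have ck := @continuous_coord R q k x.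
have cs : {for x, continuous (fun _ : 'rV[R]_q.-1 => s : R)}.
  by move=> B; exact: (@cst_continuous 'rV[R]_q.-1 R s x B).
split; first by apply: (closure_le cs ck _ cx) => y [].
by move=> l; apply: (closure_le (@continuous_coord R q l x) ck _ cx) => y [].
Qed.

Lemma closure_component_sublevel b h x y :
  closure (connected_component (sublevel q b h) x) y -> Xi y /\ F b y <= h.
Proof.
move=> cy; split.
  apply: closed_Xi => //; apply: closureS cy => z.
  by move=> /connected_component_sub[].
have ch : {for y, continuous (fun _ : 'rV[R]_q.-1 => h : R)}.
  by move=> B; exact: (@cst_continuous 'rV[R]_q.-1 R h y B).
apply: (closure_le (@continuous_F R q b y) ch _ cy) => z.
by move=> /connected_component_sub[_ /ltW].
Qed.

(** To leave the region, the component would have to cross the face at height [s] or a ridge, where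
    F is at least [h]. *)
Lemma component_dominated b s h k x :
  (forall y, Xi y -> coord y k = s -> (forall m, coord y m <= coord y k) ->
     h <= F b y) ->
  (forall l y, k != l -> ridge k l s y -> h <= F b y) ->
  dominated k s x ->
  connected_component (sublevel q b h) x `<=` dominated k s.
Proof.
move=> hs hr xk; have [Ax|nAx] := pselect (sublevel q b h x); last first.
  by rewrite connected_component_out.
apply: (connected_clopen (@component_connected _ _ _) (@open_dominated k s)
  (@closed_weakly_dominated k s)) xk => //; last exact: connected_component_refl.
- move=> y [_ [ys yk]]; split; first exact: ltW.
  by move=> l; have [->|/yk/ltW] := eqVneq l k.
- move=> y [/connected_component_sub[Xy Fy] [ys yk]].
  have ysn : coord y k != s.
    by apply: contraTneq Fy => e; rewrite -leNgt hs.
  split; first by rewrite lt_def ysn.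
  move=> l lk; rewrite lt_neqAle yk andbT; apply: contraTneq Fy => e.
  by rewrite -leNgt; apply: (hr l); [rewrite eq_sym|split].
Qed.

Lemma component_below b s h x :
  (forall k y, Xi y -> coord y k = s -> (forall m, coord y m <= coord y k) ->
     h <= F b y) ->
  (forall m, coord x m < s) ->
  connected_component (sublevel q b h) x `<=` [set y | forall m, coord y m < s].
Proof.
move=> hs xs; have [Ax|nAx] := pselect (sublevel q b h x); last first.
  by rewrite connected_component_out.
apply: (connected_clopen (@component_connected _ _ _) (@open_all_lt s)
  (@closed_all_le s)) xs => //; last exact: connected_component_refl.
- by move=> y [_ ys] m; exact: ltW.
- move=> y [/connected_component_sub[Xy Fy] ys] m.
  rewrite lt_neqAle ys andbT; apply: contraTneq Fy => e.
  by rewrite -leNgt; apply: (hs m) => // l; rewrite e.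
Qed.

(** * Critical points on the two lines *)

Lemma segment_pt1 t t' r k :
  pt1 q t k + r *: (pt1 q t' k - pt1 q t k) = pt1 q (t + r * (t' - t)) k.
Proof.
apply: coord_inj => m; rewrite coord_segment// !coord_pt1//.
case: ifP => // _; ring.
Qed.

Lemma pt2C t k l : pt2 q t k l = pt2 q t l k.
Proof. by apply/rowP => j; rewrite !mxE orbC. Qed.

(** The last clause treats both regimes: the energy climbs from u_1 up to v_1 if b < q, and up to
    1/q otherwise. *)
Lemma u1_facts b : beta_s R q 1 <= b ->
  [/\ 0 < b, 0 < u q 1 b, u q 1 b < q%:R^-1 &
   forall t t', u q 1 b <= t -> t < t' -> t' <= q%:R^-1 ->
     (b < q%:R -> t' <= v q 1 b) -> Phi q 1 b t < Phi q 1 b t'].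
Proof.
move=> bs; have [tau /andP[tau0 tauQ] [bs0 _ _ H']] := profile (R := R) one0 i1q.
have [_ /(_ bs) [/andP[u0 ut] _ _] hv _ hQ] := H' b.
have b0 : 0 < b by exact: lt_le_trans bs.
split=> //; first exact: le_lt_trans tauQ.
move=> t t' ut' tt' t'Q t'v; apply: Phi_incr => //.
- exact: lt_le_trans ut'.
- exact: le_lt_trans QJ.
move=> z tz zt'; have [bQ|Qb] := ltP b q%:R.
  have [_ _ kp _] := hv bs bQ.
  by apply: kp; [exact: le_lt_trans tz|exact: lt_le_trans (t'v bQ)].
have [kp _ _] := hQ Qb.
by apply: kp; [exact: le_lt_trans tz|exact: lt_le_trans t'Q].
Qed.

Lemma v1_right b t : beta_s R q 1 <= b -> b < q%:R -> v q 1 b < t ->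
  t <= q%:R^-1 -> Phi q 1 b t < Phi q 1 b (v q 1 b).
Proof.
move=> bs bQ vt tQ; have [b0 v0 vQ _ _] := v1_facts q5 bs bQ.
have [tau _ [_ _ _ H']] := profile (R := R) one0 i1q.
have [_ _ /(_ bs bQ) [_ _ _ kn] _ _] := H' b.
apply: Phi_decr => //; first exact: le_lt_trans QJ.
by move=> z vz zt; apply: kn => //; exact: lt_le_trans tQ.
Qed.

Lemma u1_lt_v1 b : beta_s R q 1 < b -> b < q%:R -> u q 1 b < v q 1 b.
Proof.
move=> bs bQ; have [tau _ [_ _ _ H']] := profile (R := R) one0 i1q.
by have [_ _ _ huv _] := H' b; exact: huv.
Qed.

(** Before 1/q the only critical point that can differ from u_2 is v_2, and the energy climbs from
    u_2 to v_2. *)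
Lemma critical2 b t : beta_s R q 2 <= b -> 0 < t -> t < q%:R^-1 ->
  kdiff q 2 b t = 0 -> t = u q 2 b \/ Phi q 2 b (u q 2 b) < Phi q 2 b t.
Proof.
move=> bs t0 tQ kt; have [tau _ [bs0 _ _ H']] := profile (R := R) two0 i2q.
have [_ /(_ bs) [/andP[u0 utau] ku klow] hv _ hQ] := H' b.
have b0 : 0 < b by exact: lt_le_trans bs.
have [tu|ut|->] := ltgtP t (u q 2 b); last by left.
  by have := klow t t0 tu; rewrite kt ltxx.
have [bQ|Qb] := ltP b q%:R; last first.
  by have [kp _ _] := hQ Qb; have := kp t ut tQ; rewrite kt ltxx.
have [_ _ kp kn] := hv bs bQ.
have tv : t <= v q 2 b.
  by rewrite leNgt; apply/negP => vt; have := kn t vt tQ; rewrite kt ltxx.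
right; apply: Phi_incr => //; first exact: lt_invq.
by move=> z uz zt; apply: kp => //; exact: lt_le_trans tv.
Qed.

Lemma no_critical2 b t : b < beta_s R q 2 -> 0 < t -> t < q%:R^-1 ->
  kdiff q 2 b t <> 0.
Proof.
move=> bs t0 tQ kt; have [tau _ [_ _ _ H']] := profile (R := R) two0 i2q.
by have [/(_ bs t t0 tQ)] := H' b; rewrite kt ltxx.
Qed.

Lemma critical1 b t : beta_s R q 1 <= b -> b < q%:R -> 0 < t -> t < q%:R^-1 ->
  kdiff q 1 b t = 0 -> t = u q 1 b \/ t = v q 1 b.
Proof.
move=> bs bQ t0 tQ kt; have [tau _ [_ _ _ H']] := profile (R := R) one0 i1q.
have [_ /(_ bs) [_ _ klow] /(_ bs bQ) [_ _ kp kn] _ _] := H' b.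
have [tu|ut|->] := ltgtP t (u q 1 b); last by left.
  by have := klow t t0 tu; rewrite kt ltxx.
have [tv|vt|->] := ltgtP t (v q 1 b); last by right.
  by have := kp t ut tv; rewrite kt ltxx.
by have := kn t vt tQ; rewrite kt ltxx.
Qed.

(** From q on, p is outside the sublevel set of F(v1), so its well is empty. *)
Lemma F_pp_ge_v1 b : q%:R <= b -> F b (v1 q b) <= F b (pp R q).
Proof.
move=> Qb; have [tau _ [_ bsQ _ H']] := profile (R := R) one0 i1q.
have bs : beta_s R q 1 <= b by apply: ltW; exact: lt_le_trans Qb.
have [b0 u0 uQ um] := u1_facts bs.
have [_ _ _ _ /(_ Qb) [_ vE vE']] := H' b.
rewrite F_v1E// F_pp1//.
have [bQ|Qb'|bE] := ltgtP b q%:R; last by rewrite vE.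
  by rewrite leNgt bQ in Qb.
have [->|[/andP[Qv vJ] kn]] := vE' Qb'.
  by apply: ltW; apply: um => //; rewrite ltNge Qb.
by apply: ltW; apply: Phi_decr.
Qed.

(** A minimiser at the bottom of the ridge is not in V1, as its two largest coordinates coincide, so
    the face bound is strict. Otherwise there is a critical point of the second line, which forces b
    >= beta_{s,2}. *)
Lemma ridge_v1 b k l x : beta_s R q 1 <= b -> b < q%:R -> k != l ->
  ridge k l (major1 q (v q 1 b)) x ->
  Phi q 1 b (v q 1 b) < F b x \/
  beta_s R q 2 <= b /\ (Phi q 2 b (u q 2 b) < F b x \/ x = u2pt q b k l).
Proof.
move=> bs bQ kl xr; have [b0 v0 vQ _ sb] := v1_facts q5 bs bQ.
have [vs Qs] := major1_gt q5 vQ.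
have [[y [[Xy ykl ym _] yk Fy]]|[t [/andP[t0 tQ] kt xt]]] :=
  ridge_bound q5 b0 kl (ltW sb) (ltW Qs) xr.
- left; apply: lt_le_trans Fy; apply: (F_ge_v1 q5 bs bQ Xy yk ym).
  move=> yE; move: yk; rewrite ykl yE coord_pt1// eq_sym (negPf kl) => e.
  by rewrite -e ltxx in vs.
- right; have bs2 : beta_s R q 2 <= b.
    by rewrite leNgt; apply/negP => bs2; exact: no_critical2 kt.
  split=> //; have [tE|lt] := critical2 bs2 t0 tQ kt; first by rewrite /u2pt -tE.
  left; apply: (lt_le_trans lt).
  by case: xt => [/ltW//|->]; rewrite F_pt2.
Qed.

Lemma all_le_invq x : (forall m, coord x m <= q%:R^-1) -> x = pp R q.
Proof.
move=> h; apply: coord_inj => m; rewrite coord_pp//; apply/eqP.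
rewrite eq_le h leNgt; apply/negP => xm.
have := coord_sum q0 x; apply/eqP; rewrite lt_eqF//.
have -> : 1 = \sum_(m < q) (q%:R^-1 : R).
  by rewrite sumr_const card_ord -[_ *+ _]mulr_natl divff ?gt_eqF.
by rewrite (bigD1 m)//= [ltRHS](bigD1 m)//= ltr_leD//; apply: ler_sum.
Qed.

Lemma F_u2_lt_pp b : q%:R <= b -> Phi q 2 b (u q 2 b) < F b (pp R q).
Proof.
move=> Qb; have [tau _ [_ bsQ _ H']] := profile (R := R) two0 i2q.
have bs : beta_s R q 2 <= b by apply: ltW; exact: lt_le_trans Qb.
have [b0 /andP[u0 uQ] _] := u2_facts q5 bs.
have [_ _ _ _ /(_ Qb) [kp _ _]] := H' b.
rewrite F_pp2//; apply: Phi_incr => //.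
by rewrite ltf_pV2 ?posrE ?ltr0n ?subn_gt0// ltr_nat ltn_subrL.
Qed.

(** Here the bottom of the ridge is the single point p, which lies above u2. *)
Lemma ridge_high b k l x : q%:R <= b -> k != l -> ridge k l q%:R^-1 x ->
  Phi q 2 b (u q 2 b) < F b x \/ x = u2pt q b k l.
Proof.
move=> Qb kl xr; have [tau _ [_ bsQ _ H']] := profile (R := R) two0 i2q.
have bs : beta_s R q 2 <= b by apply: ltW; exact: lt_le_trans Qb.
have b0 : 0 < b by exact: lt_le_trans Qb.
have bi : b^-1 <= q%:R^-1 by rewrite lef_pV2 ?posrE.
have [[y [[Xy ykl ym _] yk Fy]]|[t [/andP[t0 tQ] kt xt]]] :=
  ridge_bound q5 b0 kl bi (lexx _) xr.
- left; apply: lt_le_trans Fy; rewrite (@all_le_invq y) ?F_u2_lt_pp//.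
  by move=> m; rewrite -yk.
- have [tE|lt] := critical2 bs t0 tQ kt; first by rewrite /u2pt -tE.
  left; apply: (lt_le_trans lt).
  by case: xt => [/ltW//|->]; rewrite F_pt2.
Qed.

(** * The level H and its barriers *)

Lemma H_low b : b < beta3 R q -> H q b = Phi q 1 b (v q 1 b).
Proof. by move=> bb; rewrite /H bb F_v1E. Qed.

Lemma H_high b : beta3 R q <= b -> H q b = Phi q 2 b (u q 2 b).
Proof. by move=> bb; rewrite /H ltNge bb F_u2E. Qed.

Lemma H_le_v1 b : beta_s R q 1 <= b -> b < q%:R -> H q b <= Phi q 1 b (v q 1 b).
Proof.
move=> bs bQ; have [_ e _ gt] := beta3P (R := R) q5.
have [lt|bb|bE] := ltgtP b (beta3 R q); first by rewrite H_low.
  by rewrite H_high ?ltW// gt// ltW.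
by rewrite bE H_high// e.
Qed.

(** From q on, the face at the height of v1 is replaced by height 1/q: the only point with largest
    coordinate 1/q is p, and its energy exceeds F(u2). *)
Definition threshold b : R := if b < q%:R then major1 q (v q 1 b) else q%:R^-1.

Lemma threshold_level b k x : beta_s R q 1 <= b -> Xi x ->
  coord x k = threshold b -> (forall m, coord x m <= coord x k) ->
  H q b <= F b x.
Proof.
rewrite /threshold => bs Xx; case: ltP => [bQ|Qb] xk xm.
  apply: le_trans (H_le_v1 bs bQ) _.
  have [->|xn] := pselect (x = v1pt q b k); first by rewrite F_pt1.
  by apply: ltW; exact: F_ge_v1 xk xm xn.
have [/andP[_ b3Q] _ _ _] := beta3P (R := R) q5.
rewrite H_high; last by apply: ltW; exact: lt_le_trans Qb.
by rewrite (@all_le_invq x) ?ltW ?F_u2_lt_pp// => m; rewrite -xk.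
Qed.

(** The equality case is the whole contact between the wells of [k] and [l]: nothing before beta3,
    one point from beta3 on. *)
Lemma ridge_level b k l x : beta_s R q 1 <= b -> k != l ->
  ridge k l (threshold b) x ->
  H q b < F b x \/ beta3 R q <= b /\ x = u2pt q b k l.
Proof.
move=> bs kl; have [/andP[_ b3Q] e lt gt] := beta3P (R := R) q5.
rewrite /threshold; case: ltP => [bQ|Qb] xr; last first.
  have b3 : beta3 R q <= b by apply: ltW; exact: lt_le_trans Qb.
  by rewrite H_high//; have [?|?] := ridge_high Qb kl xr; [left|right].
have [h|[bs2 h]] := ridge_v1 bs bQ kl xr.
  by left; apply: le_lt_trans (H_le_v1 bs bQ) h.
have [b3|b3] := ltP b (beta3 R q); last first.
  by rewrite H_high//; case: h => h; [left|right].
left; rewrite H_low//; case: h => [h|->]; first exact: lt_trans (lt b bs2 b3) h.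
by rewrite F_pt2// lt.
Qed.

Lemma threshold_u1 b : beta_s R q 1 < b -> threshold b < major1 q (u q 1 b).
Proof.
move=> bs; have [b0 u0 uQ _] := u1_facts (ltW bs).
rewrite /threshold; case: (ltP b q%:R) => [bQ|Qb]; last by have [] := major1_gt q5 uQ.
have uv := u1_lt_v1 bs bQ.
by rewrite /major1 ltrD2l ltrN2 ltr_pM2l// ltr0n subn_gt0.
Qed.

Lemma dominated_u1 b k : beta_s R q 1 < b ->
  dominated k (threshold b) (u1pt q b k).
Proof.
move=> bs; have [b0 u0 uQ _] := u1_facts (ltW bs).
split; first by rewrite coord_pt1// eqxx; exact: threshold_u1.
move=> l lk; rewrite !coord_pt1// eqxx (negPf lk).
by have [] := major1_gt q5 uQ.
Qed.

Lemma W_dominated b k : beta_s R q 1 < b ->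
  W b (Some k) `<=` dominated k (threshold b).
Proof.
move=> bs; apply: component_dominated; last exact: dominated_u1.
  by move=> y Xy; exact: threshold_level (ltW bs) Xy.
move=> l y kl yr; have [/ltW//|[b3 ->]] := ridge_level (ltW bs) kl yr.
by rewrite H_high// F_pt2.
Qed.

Lemma closure_W b k x : beta_s R q 1 < b -> closure (W b (Some k)) x ->
  [/\ Xi x, F b x <= H q b & weakly_dominated k (threshold b) x].
Proof.
move=> bs cx; have [Xx Fx] := closure_component_sublevel cx.
split=> //; apply: closed_weakly_dominated.
apply: closureS cx => y /(W_dominated bs) [ys yk]; split; first exact: ltW.
by move=> l; have [->|/yk/ltW] := eqVneq l k.
Qed.

Lemma W_disjoint b k l : beta_s R q 1 < b ->
  W b (Some k) `&` W b (Some l) !=set0 -> k = l.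
Proof.
move=> bs [x [/(W_dominated bs) [_ xk] /(W_dominated bs) [_ xl]]].
have [//|kl] := eqVneq k l; have := xl k kl.
by rewrite eq_sym in kl; rewrite ltNge ltW ?xk.
Qed.

(** A common closure point is weakly dominated by both [k] and [l], hence on the ridge, at level at
    most H. *)
Lemma Sigma_sub b k l x : beta_s R q 1 < b -> k != l ->
  Sigma b (Some k) (Some l) x -> beta3 R q <= b /\ x = u2pt q b k l.
Proof.
move=> bs kl [/(closure_W bs) [Xx Fx [xk xkm]] /(closure_W bs) [_ _ [xl xlm]]].
have xkl : coord x k = coord x l by apply/eqP; rewrite eq_le xkm xlm.
have [lt|//] := ridge_level (ltW bs) kl (And4 Xx xkl xkm xk).
by rewrite leNgt lt in Fx.
Qed.

Lemma sublevel_pt1 b t k h : 0 < t -> t <= q%:R^-1 -> Phi q 1 b t < h ->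
  sublevel q b h (pt1 q t k).
Proof.
move=> t0 tQ Fh; split; last by rewrite F_pt1.
by apply: Xi_pt1 => //; apply: ltW => //; exact: le_lt_trans QJ.
Qed.

(** The spread ends strictly below F(u2), on the line of u1 at parameter u_2 > u_1; from there the
    energy falls to u1. So even h = F(u2) is allowed. *)
Lemma u2_end_line b k h : beta_s R q 2 <= b -> Phi q 2 b (u q 2 b) <= h ->
  connected_component (sublevel q b h) (pt1 q (u q 2 b) k) (u1pt q b k).
Proof.
move=> bs2 uh; have [b0 uI ku] := u2_facts q5 bs2; have /andP[u0 uQ] := uI.
have [l kl] : exists l, k != l.
  have [e|e] := eqVneq k (Ordinal q0); last by exists (Ordinal q0).
  by exists (Ordinal lt1q); rewrite e.
have k1 := spread_kdiff1 q5 b0 uI ku.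
have [bs1 [u12 uv]] := kdiff1_gt0 q5 u0 uQ k1.
have [_ u10 u1Q um] := u1_facts bs1.
have [TS _] := major2_gt q5 uQ.
have r0 : 0 < major2 q (u q 2 b) - u q 2 b by rewrite subr_gt0.
have FT : Phi q 1 b (u q 2 b) < h.
  apply: lt_le_trans uh; rewrite -(F_pt1 q5 _ _ k) -(F_pt2 q5 b (u q 2 b) kl).
  by rewrite -(spread_end q5 (u q 2 b) kl); apply: (spread_lt q5 b0 uI kl ku r0).
apply: segment_component => r /andP[r0' r1]; rewrite segment_pt1.
set t := u q 2 b + _; have tE : t = u q 2 b - r * (u q 2 b - u q 1 b).
  by rewrite /t; ring.
have d0 : 0 <= r * (u q 2 b - u q 1 b) by rewrite mulr_ge0// subr_ge0 ltW.
have d1 : r * (u q 2 b - u q 1 b) <= 1 * (u q 2 b - u q 1 b).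
  by rewrite ler_wpM2r// subr_ge0 ltW.
have t1 : u q 1 b <= t by lra.
have t2 : t <= u q 2 b by lra.
apply: sublevel_pt1.
- exact: lt_le_trans t1.
- by apply: ltW; exact: le_lt_trans uQ.
- apply: le_lt_trans FT; move: t2; rewrite le_eqVlt => /predU1P[->//|t2].
  by apply: ltW; apply: um => //; [exact: ltW|move=> /uv/ltW].
Qed.

Lemma spread_segment b k l h r : beta_s R q 2 <= b -> Phi q 2 b (u q 2 b) <= h ->
  k != l -> 0 < r -> r <= 1 ->
  sublevel q b h (u2pt q b k l + r *: (pt1 q (u q 2 b) k - u2pt q b k l)).
Proof.
move=> bs2 uh kl r0 r1; have [b0 uI ku] := u2_facts q5 bs2; have /andP[u0 uQ] := uI.
have [TS _] := major2_gt q5 uQ.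
rewrite -(spread_end q5 (u q 2 b) kl) segment_move//.
set d := _ - _; have d0 : 0 < d by rewrite subr_gt0.
have rd : r * d <= d by rewrite ger_pMl.
split; first by apply: spread_Xi => //; rewrite mulr_ge0// ltW.
apply: lt_le_trans uh; rewrite -(F_pt2 q5 b (u q 2 b) kl).
by apply: (spread_lt q5 b0 uI kl ku) => //; rewrite mulr_gt0.
Qed.

Lemma u2_closure b k l : beta3 R q <= b -> k != l ->
  closure (W b (Some k)) (u2pt q b k l).
Proof.
move=> b3 kl; have [/andP[b23 _] _ _ _] := beta3P (R := R) q5.
have bs2 : beta_s R q 2 <= b by apply: ltW; exact: lt_le_trans b3.
have := u2_end_line k bs2 (lexx _); rewrite -H_high// => /same_connected_component.
rewrite /W => <-; apply: half_open_segment => r /andP[r0 r1].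
by apply: spread_segment => //; rewrite H_high.
Qed.

Lemma u2_component b k l h : beta_s R q 2 <= b -> Phi q 2 b (u q 2 b) < h ->
  k != l -> connected_component (sublevel q b h) (u2pt q b k l) (u1pt q b k).
Proof.
move=> bs2 uh kl; apply: connected_component_trans (u2_end_line k bs2 (ltW uh)).
apply: segment_component => r /andP[]; rewrite le_eqVlt => /predU1P[<- _|r0 r1].
  have [b0 /andP[u0 uQ] _] := u2_facts q5 bs2.
  rewrite scale0r addr0; split; last by rewrite F_pt2.
  by apply: Xi_pt2 => //; apply: ltW => //; exact: lt_invq.
by apply: spread_segment => //; exact: ltW.
Qed.

(** Above F(u2) the wells of [k] and [l] merge: the point u2 of the pair descends to either side. *)
Lemma u1_component b k l h : beta_s R q 2 <= b -> Phi q 2 b (u q 2 b) < h ->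
  connected_component (sublevel q b h) (u1pt q b k) (u1pt q b l).
Proof.
move=> bs2 uh; have [->|kl] := eqVneq k l.
  have h1 := u2_end_line l bs2 (ltW uh).
  exact: connected_component_refl (connected_component_sub h1).
apply: (@connected_component_trans _ _ (u2pt q b k l)).
  by apply: connected_component_sym; exact: u2_component.
by rewrite /u2pt pt2C; apply: u2_component; rewrite // eq_sym.
Qed.

Lemma beta3_gt1 : beta_s R q 1 < beta3 R q.
Proof.
have [/andP[h _] _ _ _] := beta3P (R := R) q5.
by apply: le_lt_trans h; exact: beta_s12.
Qed.

Lemma W_nonempty b k : beta_s R q 1 < b -> W b (Some k) !=set0.
Proof.
move=> bs; exists (u1pt q b k); apply: connected_component_refl.
have [b0 u0 uQ um] := u1_facts (ltW bs).
have [b3|b3] := ltP b (beta3 R q).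
  have [/andP[_ b3Q] _ _ _] := beta3P (R := R) q5.
  have bQ : b < q%:R by exact: lt_trans b3Q.
  have [_ v0 vQ _ _] := v1_facts q5 (ltW bs) bQ.
  rewrite H_low//; apply: sublevel_pt1 => //; first exact: ltW.
  by apply: um => //; [exact: u1_lt_v1|exact: ltW].
have [/andP[b23 _] _ _ _] := beta3P (R := R) q5.
have bs2 : beta_s R q 2 <= b by apply: ltW; exact: lt_le_trans b3.
(* The path to u1 lies in the sublevel set, and so does its end u1. *)
have := @u2_end_line b k (H q b) bs2; rewrite H_high// => /(_ (lexx _)) h.
exact: connected_component_sub h.
Qed.

(** * The well of p and its contacts, for b below q *)

Section below_q.
Variable b : R.
Hypotheses (bs : beta_s R q 1 < b) (bQ : b < q%:R).

Let s := major1 q (v q 1 b).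

Let sE : threshold b = s. Proof. by rewrite /threshold bQ. Qed.

Let level_v1 k x : Xi x -> coord x k = s -> (forall m, coord x m <= coord x k) ->
  x <> v1pt q b k -> F b (v1 q b) < F b x.
Proof. by rewrite F_v1E//; exact: F_ge_v1 (ltW bs) bQ. Qed.

Let level_v1' k x : Xi x -> coord x k = s -> (forall m, coord x m <= coord x k) ->
  F b (v1 q b) <= F b x.
Proof.
move=> Xx xk xm; have [->|xn] := pselect (x = v1pt q b k).
  by rewrite F_v1E// F_pt1.
by apply: ltW; exact: level_v1 xk xm xn.
Qed.

Let pp_low m : coord (pp R q) m < s.
Proof.
have [_ _ vQ _ _] := v1_facts q5 (ltW bs) bQ.
by rewrite coord_pp//; have [] := major1_gt q5 vQ.
Qed.

Lemma W_None_below : W b None `<=` [set y | forall m, coord y m < s].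
Proof. by apply: component_below => // k y; exact: level_v1'. Qed.

Lemma closure_W_None x : closure (W b None) x ->
  [/\ Xi x, F b x <= F b (v1 q b) & forall m, coord x m <= s].
Proof.
move=> cx; have [Xx Fx] := closure_component_sublevel cx; split=> //.
apply: closed_all_le; apply: closureS cx => y /W_None_below ys m; exact: ltW.
Qed.

Lemma W_None_pp : W b None (pp R q).
Proof.
apply: connected_component_refl; split; first exact: Xi_pp.
have [_ _ vQ _ _] := v1_facts q5 (ltW bs) bQ.
by rewrite F_v1E// F_pp1//; apply: v1_right => //; exact: ltW.
Qed.

Lemma W_None_disjoint k : ~ (W b None `&` W b (Some k) !=set0).
Proof.
move=> [x [/W_None_below xs /(W_dominated bs) [xk _]]].
by have := xs k; rewrite -sE ltNge ltW.
Qed.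

Lemma W_trivIset : trivIset [set: option 'I_q] (W b).
Proof.
move=> [k|] [l|] _ _ //.
- by move=> /(W_disjoint bs) ->.
- by rewrite setIC => /W_None_disjoint.
- by move=> /W_None_disjoint.
Qed.

Lemma v1_closure_None k : closure (W b None) (v1pt q b k).
Proof.
have [_ v0 vQ _ _] := v1_facts q5 (ltW bs) bQ.
rewrite /W -(pt1_pp q5 k); apply: half_open_segment => r /andP[r0 r1].
rewrite segment_pt1.
have d0 : 0 < r * (q%:R^-1 - v q 1 b) by rewrite mulr_gt0// subr_gt0.
have d1 : r * (q%:R^-1 - v q 1 b) <= 1 * (q%:R^-1 - v q 1 b).
  by rewrite ler_wpM2r// subr_ge0 ltW.
have tQ : v q 1 b + r * (q%:R^-1 - v q 1 b) <= q%:R^-1 by lra.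
apply: sublevel_pt1 => //; first by lra.
by rewrite F_v1E//; apply: v1_right => //; [exact: ltW|lra].
Qed.

Lemma v1_closure_u1 k :
  closure (connected_component (sublevel q b (F b (v1 q b))) (u1pt q b k))
    (v1pt q b k).
Proof.
have [_ v0 vQ _ _] := v1_facts q5 (ltW bs) bQ.
have [_ u0 uQ um] := u1_facts (ltW bs).
have uv := u1_lt_v1 bs bQ.
apply: half_open_segment => r /andP[r0 r1]; rewrite segment_pt1.
have d0 : 0 < r * (v q 1 b - u q 1 b) by rewrite mulr_gt0// subr_gt0.
have d1 : r * (v q 1 b - u q 1 b) <= 1 * (v q 1 b - u q 1 b).
  by rewrite ler_wpM2r// subr_ge0 ltW.
set t := _ + _; have tE : t = v q 1 b - r * (v q 1 b - u q 1 b) by rewrite /t; ring.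
apply: sublevel_pt1; [lra|lra|].
by rewrite F_v1E//; apply: um; [lra|lra|exact: ltW|].
Qed.

Lemma Sigma_None_sub k x : Sigma b None (Some k) x ->
  x = v1pt q b k /\ F b x <= H q b.
Proof.
move=> [/closure_W_None [Xx Fx xs] /(closure_W bs) [_ FH [xk xm]]].
rewrite sE in xk; split=> //.
have xks : coord x k = s by apply/eqP; rewrite eq_le xs.
apply: contrapT => xn; have := level_v1 Xx xks xm xn.
by rewrite ltNge Fx.
Qed.

Lemma Sigma_None k : b <= beta3 R q -> Sigma b None (Some k) = [set v1pt q b k].
Proof.
move=> b3; have HE : H q b = F b (v1 q b).
  rewrite F_v1E//; move: b3; rewrite le_eqVlt => /predU1P[bE|b3]; last exact: H_low.
  by have [_ e _ _] := beta3P (R := R) q5; rewrite bE H_high// e.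
apply/seteqP; split=> [x /Sigma_None_sub[]//|_ ->]; split.
  exact: v1_closure_None.
by rewrite /W HE; exact: v1_closure_u1.
Qed.

Lemma component_contains x : sublevel q b (F b (v1 q b)) x ->
  connected_component (sublevel q b (F b (v1 q b))) x (pp R q) \/
  exists k, connected_component (sublevel q b (F b (v1 q b))) x (u1pt q b k).
Proof.
set A := sublevel _ _ _ => Ax; set C := connected_component A x.
have Cx : C x by exact: connected_component_refl.
have CX : closure C `<=` @Xi R q by move=> y /closure_component_sublevel[].
have [|y cy ymin] := @F_min R q q0 b _ (@closed_closure _ C) CX.
  by exists x; exact: subset_closure.
have Ay : A y.
  split; first exact: CX.
  by apply: le_lt_trans (ymin x (subset_closure Cx)) _; case: Ax.
have Cy : C y by exact: component_relatively_closed.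
have [b0 v0 vQ _ _] := v1_facts q5 (ltW bs) bQ.
have [|yE|[k [t [yE /andP[t0 tQ] kt]]]] := @stable_point R q q5 b y b0 (CX y cy).
(* A segment of lower energy starting at [y] stays in the component, against the minimality of
   [y]. *)
- move=> z Xz hz; have Cz : C z.
    apply: (connected_component_trans Cy); apply: segment_component => r /andP[].
    rewrite le_eqVlt => /predU1P[<- _|r0 r1]; first by rewrite scale0r addr0.
    have [|? Fr] := hz r; first by rewrite r0.
    by split=> //; apply: lt_trans Fr _; case: Ay.
  have [|_] := hz 1; first by rewrite ltr01 lexx.
  by rewrite scale1r addrC subrK ltNge ymin//; exact: subset_closure.
- by left; rewrite -yE.
- right; exists k; suff <- : y = u1pt q b k by [].
  have [tE|tE] := critical1 (ltW bs) bQ t0 tQ kt; first by rewrite yE tE.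
  (* The critical point v1 is excluded: its energy equals the level. *)
  by case: Ay => _; rewrite yE F_pt1// tE F_v1E// ltxx.
Qed.

End below_q.

(** Past beta3 the level F(v1) exceeds F(u2), so all of U1 lies in one component; every component
    contains p or a point of U1. *)
Lemma two_components b : beta3 R q < b -> b < q%:R ->
  exists W' : set 'rV[R]_q.-1,
    [/\ W' <> W b None,
        components (sublevel q b (F b (v1 q b))) = [set W b None; W'],
        U1 q b `<=` W' & closure (W b None) `&` closure W' = V1 q b].
Proof.
move=> b3 bQ; have [/andP[b23 _] _ _ gt] := beta3P (R := R) q5.
have bs : beta_s R q 1 < b by apply: lt_trans b3; exact: beta3_gt1.
have bs2 : beta_s R q 2 <= b by rewrite ltW// (lt_trans b23).
set A := sublevel q b (F b (v1 q b)).
have uh : Phi q 2 b (u q 2 b) < F b (v1 q b) by rewrite F_v1E// gt// ltW.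
pose k0 := Ordinal q0; pose W' := connected_component A (u1pt q b k0).
have W'k k : connected_component A (u1pt q b k) = W'.
  by apply: same_connected_component; exact: u1_component.
have u1W k : W' (u1pt q b k) by exact: u1_component.
have Au1 k : A (u1pt q b k) by exact: connected_component_sub (u1W k).
have Wpp := W_None_pp bs bQ.
have App : A (pp R q) by exact: connected_component_sub Wpp.
pose s := major1 q (v q 1 b).
have u1s k : s < coord (u1pt q b k) k.
  by have [] := dominated_u1 k bs; rewrite /threshold bQ.
(* The component of a point below height [s] stays below it, whereas W' contains points of U1, which
   are higher. *)
have W'W y : W' y -> ~ forall m, coord y m < s.
  move=> W'y ys.
  have sub : connected_component A y `<=` [set z | forall m, coord z m < s].
    apply: component_below ys => k z Xz zk zm.
    have [->|zn] := pselect (z = v1pt q b k); first by rewrite F_v1E// F_pt1.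
    by apply: ltW; rewrite F_v1E//; exact: (F_ge_v1 q5 (ltW bs) bQ Xz zk zm zn).
  have : connected_component A y (u1pt q b k0) by exact: connected_component_sym.
  by move=> /sub /(_ k0); rewrite ltNge ltW ?u1s.
exists W'; split.
- by move=> e; apply: (W'W (u1pt q b k0)); rewrite // ; apply: (W_None_below bs bQ); rewrite -e.
- apply/seteqP; split=> [_ [x Ax <-]|_ [->|->]].
  + have [h|[k h]] := component_contains bs bQ Ax.
      by left; exact: same_connected_component.
    by right; rewrite -(W'k k); exact: same_connected_component.
  + by exists (pp R q).
  + by exists (u1pt q b k0).
- by move=> _ [k _ <-]; exact: u1W.
- apply/seteqP; split=> [x [/(closure_W_None bs bQ) [Xx Fx xs] cx]|_ [k _ <-]].
    (* Otherwise a whole neighbourhood of [x] is below height [s] and misses W'. *)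
    have [k xk] : exists k, s <= coord x k.
      apply: contrapT => /forallNP h.
      have xl m : coord x m < s by rewrite ltNge; apply/negP/h.
      have [y [W'y ys]] := cx _ (coord_near_lt xl).
      exact: W'W W'y ys.
    exists k => //; apply: contrapT => xn.
    have xks : coord x k = s by apply/eqP; rewrite eq_le xs.
    have xm m : coord x m <= coord x k by rewrite xks xs.
    have := F_ge_v1 q5 (ltW bs) bQ Xx xks xm (fun e => xn (esym e)).
    by rewrite -(F_v1E q5) ltNge Fx.
  split; first exact: v1_closure_None.
  by rewrite -(W'k k); exact: v1_closure_u1.
Qed.

End wells.

Theorem theorem3p6 (R : realType) (q : nat) (hq : (5 <= q)%N) :
  [/\ beta3 R q < q%:R,
      (forall b : R, beta1 R q < b < beta3 R q ->
        [/\ forall k : option 'I_q, W b k !=set0,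
            trivIset [set: option 'I_q] (W b),
            forall k l : 'I_q, k != l -> Sigma b (Some k) (Some l) = set0 &
            forall k : 'I_q, Sigma b None (Some k) = [set v1pt q b k]]),
      (forall b : R, b = beta3 R q ->
        [/\ forall k : option 'I_q, W b k !=set0,
            trivIset [set: option 'I_q] (W b),
            forall k l : 'I_q, k != l ->
              Sigma b (Some k) (Some l) = [set u2pt q b k l] &
            forall k : 'I_q, Sigma b None (Some k) = [set v1pt q b k]]),
      (forall b : R, beta3 R q < b ->
        [/\ forall k : 'I_q, W b (Some k) !=set0,
            trivIset [set: 'I_q] (fun k => W b (Some k)),
            forall k l : 'I_q, k != l ->
              Sigma b (Some k) (Some l) = [set u2pt q b k l] &
            forall k : 'I_q, Sigma b None (Some k) = set0]) &
      (forall b : R, beta3 R q < b < q%:R ->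
        H q b < F b (v1 q b) /\
        exists W' : set 'rV[R]_q.-1,
          [/\ W' <> W b None,
              components (sublevel q b (F b (v1 q b))) =
                [set W b None; W'],
              U1 q b `<=` W' &
              closure (W b None) `&` closure W' = V1 q b])].
Proof.
have [/andP[_ b3Q] _ _ gt] := beta3P (R := R) hq.
have b13 := beta3_gt1 (R := R) hq.
have nonempty b (k : option 'I_q) : beta1 R q < b -> b < q%:R -> W b k !=set0.
  move=> bs bQ; case: k => [k|]; first exact: W_nonempty.
  by exists (pp R q); exact: W_None_pp.
have Sigma_u2 b (k l : 'I_q) : beta3 R q <= b -> k != l ->
    Sigma b (Some k) (Some l) = [set u2pt q b k l].
  move=> b3 kl; have bs : beta1 R q < b by exact: lt_le_trans b3.
  apply/seteqP; split=> [x /(Sigma_sub hq bs kl)[]//|_ ->]; split.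
    exact: u2_closure.
  by rewrite /u2pt pt2C; apply: u2_closure; rewrite // eq_sym.
split=> //.
- move=> b /andP[bs b3]; have bQ : b < q%:R by exact: lt_trans b3Q.
  split=> [k|||k].
  + exact: nonempty.
  + exact: W_trivIset.
  + move=> k l kl; apply/seteqP; split=> // x /(Sigma_sub hq bs kl)[].
    by rewrite leNgt b3.
  + by apply: Sigma_None => //; exact: ltW.
- move=> b bE; have bs : beta1 R q < b by rewrite bE.
  have bQ : b < q%:R by rewrite bE.
  split=> [k|||k].
  + exact: nonempty.
  + exact: W_trivIset.
  + by move=> k l kl; apply: Sigma_u2; rewrite ?bE.
  + by apply: Sigma_None => //; rewrite bE.
- move=> b b3; have bs : beta1 R q < b by exact: lt_trans b3.
  split=> [k|||k].
  + exact: W_nonempty.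
  + by move=> k l _ _ /(W_disjoint hq bs).
  + by move=> k l kl; apply: Sigma_u2 => //; exact: ltW.
  (* From q on the well of p is empty; below q the only candidate is v1, whose energy exceeds H. *)
  + have [bQ|Qb] := ltP b q%:R; last first.
      rewrite /Sigma (_ : W b None = set0) ?closure0 ?set0I//.
      by apply: connected_component_out => -[_]; rewrite ltNge F_pp_ge_v1.
    apply/seteqP; split=> // x /(Sigma_None_sub hq bs bQ) [-> ].
    by rewrite F_pt1// (H_high hq (ltW b3)) leNgt (gt b b3 (ltW bQ)).
- move=> b /andP[b3 bQ]; split; last exact: two_components.
  by rewrite H_high ?ltW// F_v1E// gt// ltW.
Qed.
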